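(* Suppose that $\mathbf{w}$ has type I$\alpha$. Then for every sequence of positive integers $k_n=o(n^{1/2})$, $$d_{\mathrm{TV}}\big((\mathcal{T}_n,\beta_n)^{[k_n]},(\hat{\mathcal{T}},\hat\beta)^{[k_n]}\big)\to0$$ as $n\to\infty$ with $n\equiv1\bmod\mathsf{span}(\mathbf{w})$.
   Context: Let $\mathcal{R}^\kappa$ be a weighted species (finite structure sets $\mathcal{R}[U]$ for finite sets $U$, transport bijections, relabelling-invariant weights $\kappa\ge0$), $|\mathcal{R}[k]|_\kappa=\sum_{R\in\mathcal{R}[\{1,\dots,k\}]}\kappa(R)$, and $\mathbf{w}=(\omega_k)_{k\ge0}$ with $\omega_k=|\mathcal{R}[k]|_\kappa/k!$, assumed to satisfy $\omega_0>0$ and $\omega_k>0$ for some $k\ge2$. $\mathsf{span}(\mathbf{w})$ is the gcd of $\{k:\omega_k>0\}$. $\mathcal{T}_n$ is the random plane tree with $n$ vertices drawn with probability proportional to $\prod_v\omega_{d^+(v)}$ ($d^+$ = outdegree). $(\mathcal{T}_n,\beta_n)$: conditionally on $\mathcal{T}_n$, independently for each vertex $v$, $\beta_n(v)\in\mathcal{R}[\{1,\dots,d^+(v)\}]$ is chosen with probability $\kappa(\beta_n(v))/|\mathcal{R}[d^+(v)]|_\kappa$ (label $i$ corresponds to the $i$-th child). Let $\phi(z)=\sum_k\omega_kz^k$ with radius $\rho_\phi$; if $\rho_\phi>0$, $\psi(t)=t\phi'(t)/\phi(t)$ and $\nu=\lim_{t\uparrow\rho_\phi}\psi(t)\in(0,\infty]$,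 else $\nu=0$. If $\nu\ge1$, $\tau\in(0,\rho_\phi]$ is the unique solution of $\psi(\tau)=1$, else $\tau=\rho_\phi$. $\pi_k=\tau^k\omega_k/\phi(\tau)$ is a probability distribution with mean $\mu=\min(\nu,1)$ and variance $\sigma^2=\tau\psi'(\tau)\in(0,\infty]$. Type I$\alpha$ means $\nu\ge1$ and $\sigma^2<\infty$. Modified Galton--Watson tree $\hat{\mathcal{T}}$: with $\xi\sim(\pi_k)$ and $\hat\xi$ with $\mathbb{P}(\hat\xi=k)=k\pi_k$, $\mathbb{P}(\hat\xi=\infty)=1-\mu$: the root is special; normal vertices have an independent copy of $\xi$ children, all normal; special vertices have an independent copy of $\hat\xi$ children, all normal if infinitely many, otherwise one uniformly chosen child is special and the rest normal. $(\hat{\mathcal{T}},\hat\beta)$: conditionally on $\hat{\mathcal{T}}$, each vertex of finite outdegree $d$ independently gets $\hat\beta(v)\in\mathcal{R}[\{1,\dots,d\}]$ with probability proportional to $\kappa$. Trimming: for an enriched plane tree $(T,\alpha)$ and $k\ge1$, $(T,\alpha)^{[k]}=(T^{[k]},(\alpha(v))_{v\in T^{[k-1]}})$, where $T^{[j]}$ is obtained from $T$ by deleting all vertices of height greater than $j$. $d_{\mathrm{TV}}$ is total variation distance. *)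

(* Defs.v *)
From Stdlib Require Import Reals ClassicalEpsilon.
From HB Require Import structures.
From mathcomp Require Import all_boot all_fingroup.

Set Implicit Arguments.
Unset Strict Implicit.
Unset Printing Implicit Defensive.

Local Open Scope R_scope.

(* Weighted species, presented on the canonical label sets {0,..,k-1} (which   *)
(* is equivalent to a species on all finite sets): a finite set of structures  *)
(* for each k, transport along relabellings (a functorial action of S_k), and  *)
(* a relabelling-invariant nonnegative weight kappa.                           *)
(* Label i (0-based) corresponds to the (i+1)-th child.                        *)
Record wspecies := WSpecies {
  sp_struct : nat -> finType;
  sp_transport : forall k, {perm 'I_k} -> sp_struct k -> sp_struct k;
  sp_transport1 : forall k x, sp_transport (1%g : {perm 'I_k}) x = x;
  sp_transportM : forall k (s t : {perm 'I_k}) x,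
      sp_transport (s * t)%g x = sp_transport t (sp_transport s x);
  sp_weight : forall k, sp_struct k -> R;
  sp_weight_nonneg : forall k (x : sp_struct k), 0 <= sp_weight x;
  sp_weight_inv : forall k (s : {perm 'I_k}) x,
      sp_weight (sp_transport s x) = sp_weight x
}.

Definition rsum {T} (l : seq T) (f : T -> R) : R :=
  foldr (fun x acc => f x + acc) 0 l.
Definition rprod (l : seq R) : R := foldr Rmult 1 l.

Section Defs.
Variable S : wspecies.

Definition kmass (k : nat) : R := rsum (enum (sp_struct S k)) (@sp_weight S k).

Definition omega (k : nat) : R := kmass k / INR (k`!)%N.

Definition is_span (d : nat) : Prop :=
  (forall k, 0 < omega k -> (d %| k)%N) /\
  (forall d', (forall k, 0 < omega k -> (d' %| k)%N) -> (d' %| d)%N).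

Definition phi_at (t Phi : R) : Prop :=
  infinite_sum (fun k => omega k * t ^ k) Phi.

(* Type I alpha, with tau its (unique) parameter and Phi = phi(tau):
   tau > 0, phi(tau) = Phi < oo, psi(tau) = tau phi'(tau)/phi(tau) = 1
   (i.e. nu >= 1 and tau solves psi(tau) = 1; mu = 1), and
   sigma^2 = Var(pi) = tau psi'(tau) < oo. *)
Definition typeIalpha_tau (tau Phi : R) : Prop :=
  0 < tau /\ phi_at tau Phi /\
  infinite_sum (fun k => INR k * (omega k * tau ^ k)) Phi /\
  exists V, infinite_sum (fun k => INR k ^ 2 * (omega k * tau ^ k)) V.

Definition pi_tau (tau Phi : R) (k : nat) : R := tau ^ k * omega k / Phi.

Inductive ptree := PNode of seq ptree.

(* partially enriched plane trees: [Cut] is an undecorated vertex without     *)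
(* children (a vertex at height k of a trimmed tree); [DNode d a ch] is a      *)
(* vertex with decoration a in R[{1..d}] and children ch (well-formed if       *)
(* size ch = d).  Enriched plane trees are those without [Cut].                *)
Inductive ttree :=
  | Cut
  | DNode (d : nat) (a : sp_struct S d) (ch : seq ttree).

Fixpoint trim (k : nat) (t : ttree) : ttree :=
  match k with
  | 0 => Cut
  | k'.+1 => match t with
             | Cut => Cut
             | DNode d a ch => DNode a (map (trim k') ch)
             end
  end.

Fixpoint shapes (fuel n : nat) {struct fuel} : seq ptree :=
  match fuel with
  | 0 => [::]
  | fuel'.+1 =>
    let fix forests (d m : nat) {struct d} : seq (seq ptree) :=
      match d with
      | 0 => if m == 0%N then [:: [::]] else [::]
      | d'.+1 => flatten [seq [seq t :: f | t <- shapes fuel' m1,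
                                                 f <- forests d' (m - m1)%N]
                          | m1 <- iota 1 m]
      end in
    match n with
    | 0 => [::]
    | n'.+1 => [seq PNode f | d <- iota 0 n, f <- forests d n']
    end
  end.

Definition plane_trees (n : nat) : seq ptree := shapes n n.

Fixpoint shape_weight (T : ptree) : R :=
  let: PNode ch := T in
  let fix w (l : seq ptree) : R :=
    match l with [::] => 1 | c :: l' => shape_weight c * w l' end in
  omega (size ch) * w ch.

Fixpoint decorate (T : ptree) : seq ttree :=
  let: PNode ch := T in
  let fix decf (l : seq ptree) : seq (seq ttree) :=
    match l with
    | [::] => [:: [::]]
    | c :: l' => [seq t :: f | t <- decorate c, f <- decf l']
    end in
  [seq DNode a f | a <- enum (sp_struct S (size ch)), f <- decf ch].

Fixpoint dec_prob (t : ttree) : R :=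
  match t with
  | Cut => 1
  | DNode d a ch => sp_weight a / kmass d * rprod (map dec_prob ch)
  end.

Definition Zn (n : nat) : R := rsum (plane_trees n) shape_weight.

Definition indicator (P : Prop) : R :=
  if excluded_middle_informative P then 1 else 0.

Definition law_Tn (k n : nat) (t : ttree) : R :=
  rsum (plane_trees n) (fun T =>
    shape_weight T / Zn n *
    rsum (decorate T) (fun tb => dec_prob tb * indicator (trim k tb = t))).

(* law of the trimming at height k of the (enriched) Galton-Watson tree rooted *)
(* at a normal vertex, offspring law pi *)
Fixpoint lawN (pi : nat -> R) (k : nat) (t : ttree) : R :=
  match k, t with
  | 0, Cut => 1
  | 0, DNode _ _ _ => 0
  | _.+1, Cut => 0
  | k'.+1, DNode d a ch =>
      if size ch == d then
        pi d * (sp_weight a / kmass d) * rprod (map (lawN pi k') ch)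
      else 0
  end.

(* same, rooted at a special vertex: P(hat xi = d) = d pi_d, the special child *)
(* is uniform among the d children.  (The event hat xi = oo has probability     *)
(* 1 - mu = 0 under type I alpha.)                                              *)
Fixpoint lawS (pi : nat -> R) (k : nat) (t : ttree) : R :=
  match k, t with
  | 0, Cut => 1
  | 0, DNode _ _ _ => 0
  | _.+1, Cut => 0
  | k'.+1, DNode d a ch =>
      if size ch == d then
        INR d * pi d * (sp_weight a / kmass d) *
        rsum (iota 0 d) (fun j =>
          / INR d * lawS pi k' (nth Cut ch j) *
          rprod [seq lawN pi k' (nth Cut ch i) | i <- iota 0 d & i != j])
      else 0
  end.

Definition law_hat (pi : nat -> R) (k : nat) (t : ttree) : R := lawS pi k t.

End Defs.

Arguments law_Tn S k n t : clear implicits.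
Arguments law_hat S pi k t : clear implicits.
Arguments lawN S pi k t : clear implicits.
Arguments lawS S pi k t : clear implicits.
Arguments trim S k t : clear implicits.

(* d_TV(p, q) <= e, for laws p, q on a countable set: (1/2) sum |p - q| <= e, *)
(* i.e. the sup over finite sets of the partial sums is <= e.                  *)
Definition dTV_le {T} (p q : T -> R) (e : R) : Prop :=
  forall l : seq T, List.NoDup l ->
    / 2 * rsum l (fun x => Rabs (p x - q x)) <= e.

(* Main.v *)
Require Import Defs.
From Stdlib Require Import Reals Lra Lia Eqdep_dec.
From Coquelicot Require Import Hierarchy Continuity Derive AutoDerive RInt RInt_analysis.
From HB Require Import structures.
From mathcomp Require Import all_boot all_order all_algebra all_fingroup.
From mathcomp Require Import Rstruct boolp complex zify.
Set Implicit Arguments.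
Unset Strict Implicit.
Unset Printing Implicit Defensive.
Import GRing.Theory Num.Theory.
Local Open Scope R_scope.

(** Let [t] be a trimmed enriched tree with [m] decorated vertices and [L] cut vertices,
    and let [lawN t] be its probability for the Galton-Watson tree with offspring law [pi].
    Under the modified tree it has probability [L * lawN t]; under [T_n] it has probability
    [lawN t] times the quotient of the probabilities that a forest of [L] trees has [n - m]
    vertices and that a single tree has [n] vertices.  Lagrange inversion (the cycle lemma)
    turns the quotient of the two laws into
      [n / (n - m) * P(S_(n-m) = n - m - L) / P(S_n = n - 1)]
    where [S] is the random walk with step law [pi].  By the local limit theorem it tends to
    [1] uniformly for [m = o(n)], [L = o(sqrt n)].  Under the modified tree [L] has mean
    [O(k)] and [m] has mean [O(k^2)], so for [k = o(sqrt n)] these trees carry almost all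
    the mass.

    The local limit theorem is proved by Fourier inversion over [[0, pi/span]], after
    truncating the step law (which does not change the finitely many coefficients that
    matter): near the origin the characteristic function is compared with a Gaussian,
    elsewhere its modulus is at most [1 - c x^2]. *)

(** Everything infinite is replaced by finite data: generating functions are polynomials cut at a
    degree, trees range over a finite enumeration with bounded outdegrees, and the step law is
    truncated at a level chosen after [N], so that its error is a small multiple of [1 / N]. The
    factor [L] is the size bias of the spine: an expectation under the modified tree is one under
    the Galton-Watson tree with weight [L]. The moments of the overview are thus mixed second
    moments of a critical branching process, which finite variance controls. The constant of the
    local limit theorem is never identified. It is a Gaussian integral over a bounded interval that
    depends on the precision asked for; its lower bound does not, which turns the error into a
    relative one, and the constant cancels in the quotient. Periodicity enters twice. The modulus of
    the characteristic function has period [2 * PI / span], which dictates the interval of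
    integration; and the walk only reaches multiples of [span], which is consistent because [m + L]
    is congruent to 1 for every tree of positive probability. *)

Local Notation "\rsum_ ( i <- r ) F" := (\big[Rplus/0]_(i <- r) F)
  (at level 36, F at level 36, i, r at level 50).
Local Notation "\rsum_ ( i < n ) F" := (\big[Rplus/0]_(i < n) F)
  (at level 36, F at level 36, i, n at level 50).
Local Notation "\rprod_ ( i <- r ) F" := (\big[Rmult/1]_(i <- r) F)
  (at level 36, F at level 36, i, r at level 50).
Local Notation "p `_ i" := (nth (GRing.zero : R) (polyseq p) i).

(** * Lagrange inversion *)

Section Lagrange.
Local Open Scope ring_scope.
Variables (F : numFieldType) (w f : nat -> F) (B : nat).
(* Series are truncated at degree [B]: only the coefficients up to [B] are meaningful. *)
Let phi := \poly_(k < B.+1) w k.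
Let T := \poly_(i < B.+1) f i.
Hypothesis f0 : f 0 = 0.
Hypothesis fS : forall n, (n < B)%N -> f n.+1 = \sum_(d < B.+1) w d * (T ^+ d)`_n.

Lemma coefM_trunc (p q r : {poly F}) n :
  (forall i, (i <= n)%N -> p`_i = q`_i) -> (p * r)`_n = (q * r)`_n.
Proof.
by move=> h; rewrite !coefM; apply: eq_bigr => i _; rewrite h // -ltnS.
Qed.

Lemma coef_exp_lt L n : (n < L)%N -> (T ^+ L)`_n = 0.
Proof.
have -> : T = 'X * \poly_(i < B) f i.+1.
  by apply/polyP => -[|i]; rewrite coefXM /T !coef_poly.
by move=> nL; rewrite exprMn coefXnM nL.
Qed.

(** Deleting the root of the first tree, of outdegree [d], turns a forest of [L + 1] trees with
    [N + 1] vertices into one of [d + L] trees with [N] vertices. Algebraically, one factor [T] is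
    replaced by ['X] times the sum of the [w d *: T ^+ d], which agrees with it up to the degree
    that is read off. *)
Lemma forest_recursion L N : (N < B)%N ->
  (T ^+ L.+1)`_N.+1 = \sum_(d < B.+1) w d * (T ^+ (d + L))`_N.
Proof.
move=> NB; rewrite exprS.
rewrite (@coefM_trunc _ ('X * \sum_(d < B.+1) w d *: T ^+ d)).
  rewrite -mulrA coefXM /= mulr_suml coef_sum.
  by apply: eq_bigr => d _; rewrite -scalerAl coefZ -exprD.
move=> [|i] iN; rewrite coefXM [LHS]coef_poly //=.
rewrite ltnS (leq_trans iN NB) fS ?(leq_trans iN NB) // coef_sum.
by apply: eq_bigr => d _; rewrite coefZ.
Qed.

Lemma coef_phi_expS N a : (a <= B)%N ->
  (phi ^+ N.+1)`_a = \sum_(d < a.+1) w d * (phi ^+ N)`_(a - d).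
Proof.
move=> aB; rewrite exprS coefM; apply: eq_bigr => d _.
by rewrite coef_poly (leq_trans (ltn_ord d)).
Qed.

(** Both sides are the coefficient of ['X] times the derivative of [phi ^+ N.+1]. In terms of a
    walk: given the sum of [N + 1] exchangeable steps, each step has conditional mean
    [a / (N + 1)]. *)
Lemma coef_phi_exp_deriv N a : (a <= B)%N ->
  a%:R * (phi ^+ N.+1)`_a =
  N.+1%:R * \sum_(d < a.+1) d%:R * w d * (phi ^+ N)`_(a - d).
Proof.
move=> aB.
have <- : ('X * (phi ^+ N.+1)^`())`_a = a%:R * (phi ^+ N.+1)`_a.
  by rewrite coefXM; case: a aB => [|a] _; rewrite ?mul0r //= coef_deriv mulr_natl.
rewrite deriv_exp /= mulrnAr coefMn -[LHS]mulr_natl mulrA; congr (_ * _).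
rewrite coefM; apply: eq_bigr => -[d da] _ /=; congr (_ * _).
rewrite coefXM; case: d da => [|d] da; first by rewrite mul0r.
by rewrite coef_deriv coef_poly (leq_trans da) // mulr_natl.
Qed.

(** Induction on [N] along [forest_recursion], which avoids compositional inverses of truncated
    series. The induction hypothesis brings the factor [d + L]: its part [L] is summed by
    [coef_phi_expS], its part [d] by [coef_phi_exp_deriv], and [L * (N + 1) + (N - L) = N * (L + 1)]
    closes the step. *)
Theorem lagrange_forest N L : (N <= B)%N -> (L <= N)%N ->
  N%:R * (T ^+ L)`_N = L%:R * (phi ^+ N)`_(N - L).
Proof.
elim: N L => [|N IH] [|L] // NB LN.
  by rewrite expr0 coef1 mulr0 mul0r.
rewrite ltnS in LN; rewrite forest_recursion // subSS.
have aB : (N - L <= B)%N by lia.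
(* Outdegrees above [N - L] contribute nothing: more than [N] trees cannot share [N] vertices. *)
rewrite (eq_bigr (fun d : 'I_B.+1 => if (d < (N - L).+1)%N then
    w d * (T ^+ (d + L))`_N else 0)); last first.
  by move=> d _; case: ltnP => // h; rewrite coef_exp_lt ?mulr0 //; lia.
rewrite -big_mkcond /= -(big_ord_widen _ (fun d => w d * (T ^+ (d + L))`_N)) //.
(* The induction hypothesis carries the factor [N], which has to be cancelled; the one-vertex case
   is computed directly. *)
have [N0|N0] := posnP N.
  have L0 : L = 0%N by lia.
  rewrite N0 L0 subnn !big_ord_recl !big_ord0 /= expr0 expr1 coef_poly /=.
  by rewrite coef1 mulr1 !mul1r addr0.
apply: (@mulfI _ N%:R); first by rewrite pnatr_eq0 -lt0n.
rewrite mulrCA mulr_sumr (eq_bigr (fun d : 'I_(N - L).+1 =>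
   L%:R * (w d * (phi ^+ N)`_(N - L - d)) + d%:R * w d * (phi ^+ N)`_(N - L - d))).
  rewrite big_split -mulr_sumr -coef_phi_expS // mulrDr -coef_phi_exp_deriv //.
  by rewrite mulrA -mulrDl -natrM -natrD mulrA -natrM; congr (_%:R * _); nia.
move=> [d dN] _ /=; rewrite mulrCA IH; [|lia|lia].
by rewrite natrD mulrDl mulrDr subnDA subnAC addrC -!mulrA mulrCA; congr (_ + _); rewrite mulrCA.
Qed.

End Lagrange.

(** * Generating functions of trimmed trees *)

Section TreeSums.
Variable S : wspecies.
Local Notation ttree := (ttree S).

Lemma rsumE T (l : seq T) (f : T -> R) : rsum l f = \rsum_(x <- l) f x.
Proof. by elim: l => [|x l IH]; rewrite ?big_nil ?big_cons //= IH. Qed.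

Lemma rprodE T (l : seq T) (f : T -> R) :
  rprod (map f l) = \rprod_(x <- l) f x.
Proof. by elim: l => [|x l IH]; rewrite ?big_nil ?big_cons //= IH. Qed.

Lemma indicator_true (P : Prop) : P -> indicator P = 1.
Proof. by rewrite /indicator; case: ClassicalEpsilon.excluded_middle_informative. Qed.

Lemma indicator_false (P : Prop) : ~ P -> indicator P = 0.
Proof. by rewrite /indicator; case: ClassicalEpsilon.excluded_middle_informative. Qed.

Lemma indicator_and (P Q : Prop) : indicator (P /\ Q) = indicator P * indicator Q.
Proof.
have [p|p] := EM P; last by rewrite (indicator_false p) indicator_false ?Rmult_0_l // => -[].
have [q|q] := EM Q; first by rewrite !indicator_true ?Rmult_1_l.
by rewrite (indicator_false q) indicator_false ?Rmult_0_r // => -[].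
Qed.

Section Forests.
Variable sh : nat -> seq ptree.
(** The anonymous inner fixpoint of [shapes] under a name; it is convertible to the original, so
    [shapesS] holds by computation. *)
Fixpoint forests (d m : nat) {struct d} : seq (seq ptree) :=
  match d with
  | 0 => if m == 0%N then [:: [::]] else [::]
  | d'.+1 => flatten [seq [seq t :: f | t <- sh m1, f <- forests d' (m - m1)%N]
                     | m1 <- iota 1 m]
  end.
End Forests.

Lemma shapesS fuel n : shapes fuel.+1 n.+1 =
  [seq PNode f | d <- iota 0 n.+1, f <- forests (shapes fuel) d n].
Proof. by []. Qed.

Lemma eq_forests sh1 sh2 d m : (forall i, (i <= m)%N -> sh1 i = sh2 i) ->
  forests sh1 d m = forests sh2 d m.
Proof.
elim: d m => //= d IH m h; congr flatten; apply/eq_in_map => i.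
rewrite mem_iota => /andP [i1 im]; rewrite h; last by lia.
by rewrite IH // => j jm; apply: h; lia.
Qed.

Lemma shapes_fuel fuel n : (n <= fuel)%N -> shapes fuel n = shapes n n.
Proof.
suff h fuel1 fuel2 : (n <= fuel1)%N -> (n <= fuel2)%N -> shapes fuel1 n = shapes fuel2 n.
  by move=> nf; apply: h.
elim: fuel1 fuel2 n => [|f1 IH] [|f2] [|n] // h1 h2.
rewrite !shapesS; congr flatten; apply: eq_map => d; congr map.
by apply: eq_forests => i im; apply: IH; lia.
Qed.

Lemma plane_treesS n : plane_trees n.+1 =
  [seq PNode f | d <- iota 0 n.+1, f <- forests plane_trees d n].
Proof.
rewrite /plane_trees shapesS; congr flatten; apply: eq_map => d; congr map.
by apply: eq_forests => i im; apply: shapes_fuel.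
Qed.

Lemma forests_gt sh d m : (m < d)%N -> forests sh d m = [::].
Proof.
elim: d m => // d IH m md /=.
have -> : [seq [seq t :: f | t <- sh m1, f <- forests sh d (m - m1)] | m1 <- iota 1 m]
   = [seq [::] | m1 <- iota 1 m].
  apply/eq_in_map => i; rewrite mem_iota => /andP [i1 im].
  by rewrite IH ?allpairs0r //; lia.
by elim: (iota 1 m).
Qed.

Lemma size_forests sh d m f : List.In f (forests sh d m) -> size f = d.
Proof.
elim: d m f => [|d IH] m f /=.
  by case: ifP => //= _ [<-|].
elim: (iota 1 m) => //= i l IHl /List.in_app_iff [|//].
elim: (sh i) => //= t s IHs /List.in_app_iff [|//].
by move/List.in_map_iff => [g [<- /IH /= ->]].
Qed.

(** The value 0 on lists of different lengths reflects that children cannot be matched with a forest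
    of another size. *)
Fixpoint prod2 (A C : Type) (h : A -> C -> R) (l : seq A) (l' : seq C) : R :=
  match l, l' with
  | [::], [::] => 1
  | a :: l, c :: l' => h a c * prod2 h l l'
  | _, _ => 0
  end.

Lemma prod2_size (A C : Type) (h : A -> C -> R) l l' : size l <> size l' -> prod2 h l l' = 0.
Proof.
elim: l l' => [|a l IH] [|c l'] //= ne; rewrite IH ?Rmult_0_r // => e.
by apply: ne; rewrite e.
Qed.

Lemma prod2_mull (A C : Type) (w : A -> R) (h : A -> C -> R) l l' : size l = size l' ->
  prod2 (fun a c => w a * h a c) l l' = (\rprod_(a <- l) w a) * prod2 h l l'.
Proof.
elim: l l' => [|a l IH] [|c l'] //=; rewrite ?big_nil ?big_cons; first by rewrite Rmult_1_l.
by case=> /IH ->; ring.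
Qed.

Lemma coefMR (p q : {poly R}) n :
  (p * q)%R`_n = \rsum_(i < n.+1) (p`_i * q`_(n - i)).
Proof. exact: coefM. Qed.

(** The product rule for generating functions of ordered forests. The generating functions are only
    assumed correct up to degree [m], so that truncated polynomials qualify; [sh 0] is empty because
    [forests] lets sizes start at 1. *)
Lemma sum_forests (sh : nat -> seq ptree) (C : Type) (h : ptree -> C -> R)
    (P : C -> {poly R}) (ch : seq C) m :
  (forall i c, (i <= m)%N -> \rsum_(t <- sh i) h t c = (P c)`_i) -> sh 0%N = [::] ->
  \rsum_(f <- forests sh (size ch) m) prod2 h f ch = (\prod_(c <- ch) P c)%R`_m.
Proof.
move=> hP sh0; elim: ch m hP => [|c ch IH] m hP /=.
  rewrite big_nil coef1; case: eqP => _; rewrite ?big_nil //.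
  by rewrite big_cons big_nil /= Rplus_0_r.
rewrite big_cons coefMR big_ord_recl -hP // sh0 big_nil Rmult_0_l Rplus_0_l.
rewrite big_flatten big_map.
rewrite -[1%N]addn0 iotaDl big_map -(val_enum_ord m) big_map big_enum /=.
apply: eq_bigr => i _; rewrite big_allpairs_dep /= -hP; last first.
  exact: ltn_ord.
rewrite big_distrl /=; apply: eq_bigr => t _; rewrite -IH; last by move=> j d jm; apply: hP; rewrite (leq_trans jm) ?leq_subr.
by rewrite big_distrr.
Qed.

Fixpoint lprod (A : Type) (ls : seq (seq A)) : seq (seq A) :=
  match ls with
  | [::] => [:: [::]]
  | l :: ls' => [seq t :: f | t <- l, f <- lprod ls']
  end.

Lemma decorateE ch : decorate S (PNode ch) =
  [seq DNode a f | a <- enum (sp_struct S (size ch)), f <- lprod (map (decorate S) ch)].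
Proof. by rewrite /=; congr allpairs_dep; apply/funext => _; elim: ch => //= c l ->. Qed.

Lemma shape_weightE ch : shape_weight S (PNode ch) =
  omega S (size ch) * \rprod_(c <- ch) shape_weight S c.
Proof.
by rewrite /=; congr Rmult; elim: ch => [|c l IH]; rewrite ?big_nil ?big_cons //= IH.
Qed.

Local Arguments shape_weight : simpl never.

Lemma DNode_inj d (a b : sp_struct S d) f g : DNode a f = DNode b g -> a = b /\ f = g.
Proof.
move=> e; split; last by case: e.
have : existT (fun d => sp_struct S d : Type) d a = existT _ d b by case: e.
exact: (inj_pair2_eq_dec _ PeanoNat.Nat.eq_dec).
Qed.

(** For a shape of positive weight, the conditional probability that its random decoration trims to
    [t]. *)
Definition trim_mass k (T : ptree) (t : ttree) :=
  \rsum_(tb <- decorate S T) (dec_prob tb * indicator (trim S k tb = t)).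

Lemma trim_mass_forest k f ch :
  \rsum_(g <- lprod (map (decorate S) f))
     ((\rprod_(t <- g) dec_prob t) * indicator (map (trim S k) g = ch))
  = prod2 (trim_mass k) f ch.
Proof.
elim: f ch => [|T f IH] [|t ch] /=.
- by rewrite big_cons !big_nil indicator_true // Rmult_1_l Rplus_0_r.
- by rewrite big_cons !big_nil indicator_false // Rmult_0_r Rplus_0_r.
- rewrite big_allpairs_dep big1 // => x _; rewrite big1 // => y _.
  by rewrite indicator_false // Rmult_0_r.
rewrite big_allpairs_dep /= -IH /trim_mass big_distrl; apply: eq_bigr => x _ /=.
rewrite big_distrr; apply: eq_bigr => y _ /=; rewrite big_cons.
have -> : indicator (trim S k x :: map (trim S k) y = t :: ch) =
   indicator (trim S k x = t /\ map (trim S k) y = ch).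
  by congr indicator; apply/propext; split=> [[-> ->]|[-> ->]].
rewrite indicator_and; ring.
Qed.

Lemma trim_mass_node k f d (a : sp_struct S d) ch :
  trim_mass k.+1 (PNode f) (DNode a ch) =
  if size f == d then sp_weight a / kmass S d * prod2 (trim_mass k) f ch else 0.
Proof.
rewrite /trim_mass decorateE big_allpairs_dep /=; case: eqP => [e|ne]; last first.
  rewrite big1 // => x _; rewrite big1 // => y _.
  by rewrite indicator_false ?Rmult_0_r // => -[e] _; case: ne.
subst d; rewrite (bigD1_seq a) ?enum_uniq ?mem_enum //= -[RHS]Rplus_0_r; congr Rplus.
  rewrite -trim_mass_forest big_distrr; apply: eq_bigr => y _ /=; rewrite rprodE.
  have -> : (DNode a (map (trim S k) y) = DNode a ch) = (map (trim S k) y = ch).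
    by apply/propext; split=> [/DNode_inj []|->].
  ring.
rewrite big1 // => x /eqP ne; rewrite big1 // => y _.
by rewrite indicator_false ?Rmult_0_r // => /DNode_inj [].
Qed.

Lemma kmass_eq k : kmass S k = \rsum_(a <- enum (sp_struct S k)) sp_weight a.
Proof. exact: rsumE. Qed.

Lemma INR_fact_gt0 k : 0 < INR k`!.
Proof. by apply: lt_0_INR; apply/ltP; apply: fact_gt0. Qed.

Lemma rsum_ge0 T (l : seq T) (f : T -> R) : (forall x, 0 <= f x) -> 0 <= \rsum_(x <- l) f x.
Proof.
by move=> f0; elim/big_rec: _ => [|x y _ h]; [lra|]; have := f0 x; lra.
Qed.

Lemma kmass_ge0 k : 0 <= kmass S k.
Proof. by rewrite kmass_eq; apply: rsum_ge0 => a; apply: sp_weight_nonneg. Qed.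

Lemma omega_ge0 k : 0 <= omega S k.
Proof.
apply: Rmult_le_pos; first exact: kmass_ge0.
by apply: Rlt_le; apply: Rinv_0_lt_compat; apply: INR_fact_gt0.
Qed.

(** The quotient is 1, except for outdegrees of zero mass, where it is 0 by the convention on
    division and [omega] vanishes as well. *)
Lemma omega_kmass k : omega S k * (kmass S k / kmass S k) = omega S k.
Proof.
have [->|k0] := Req_dec (omega S k) 0; first by rewrite Rmult_0_l.
by field => h; apply: k0; rewrite /omega h /Rdiv Rmult_0_l.
Qed.

Lemma ptree_ind_forall (P : ptree -> Prop) :
  (forall l, List.Forall P l -> P (PNode l)) -> forall T, P T.
Proof.
move=> H; fix IH 1 => -[l]; apply: H.
by elim: l => [|T l IHl]; constructor.
Qed.

Lemma ttree_ind_forall (P : ttree -> Prop) : P (Cut S) ->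
  (forall d (a : sp_struct S d) ch, List.Forall P ch -> P (DNode a ch)) -> forall t, P t.
Proof.
move=> H0 H; fix IH 1 => -[|d a ch]; first exact: H0.
by apply: H; elim: ch => [|t ch IHch]; constructor.
Qed.

Lemma ratio_kmass_ge0 d (a : sp_struct S d) : 0 <= sp_weight a / kmass S d.
Proof.
rewrite /Rdiv; apply: Rmult_le_pos; first exact: sp_weight_nonneg.
have [->|h] := Req_dec (kmass S d) 0; first by rewrite Rinv_0; lra.
by apply/Rlt_le/Rinv_0_lt_compat; have := kmass_ge0 d; lra.
Qed.

Lemma dec_prob_ge0 t : 0 <= @dec_prob S t.
Proof.
elim/ttree_ind_forall: t => [|d a ch h] /=; first lra.
apply: Rmult_le_pos; first exact: ratio_kmass_ge0.
by elim: h => [|t l t0 _ IH] /=; [lra|apply: Rmult_le_pos].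
Qed.

Lemma sum_dec_probE f : \rsum_(tb <- decorate S (PNode f)) dec_prob tb =
  kmass S (size f) / kmass S (size f) *
  \rprod_(T <- f) (\rsum_(tb <- decorate S T) dec_prob tb).
Proof.
rewrite decorateE big_allpairs_dep /= [X in _ = X / _ * _]kmass_eq /Rdiv big_distrl big_distrl.
apply: eq_bigr => a _ /=; rewrite -big_distrr /=; congr Rmult.
elim: f {a} => [|T f IH] /=; first by rewrite big_cons !big_nil /=; ring.
rewrite big_allpairs_dep big_cons -IH big_distrl; apply: eq_bigr => t _ /=.
by rewrite big_distrr.
Qed.

Lemma sum_dec_prob_le1 T : 0 <= \rsum_(tb <- decorate S T) dec_prob tb <= 1.
Proof.
elim/ptree_ind_forall: T => f h; rewrite sum_dec_probE.
have : 0 <= kmass S (size f) / kmass S (size f) <= 1.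
  have [->|h0] := Req_dec (kmass S (size f)) 0; first by rewrite /Rdiv Rmult_0_l; lra.
  by rewrite /Rdiv Rinv_r //; lra.
suff : 0 <= \rprod_(T <- f) (\rsum_(tb <- decorate S T) dec_prob tb) <= 1 by nra.
elim: h => [|T l hT _ IH]; rewrite ?big_nil ?big_cons; [lra|nra].
Qed.

(** The decoration probabilities sum to 1 unless the shape has an outdegree of zero mass; such a
    shape has weight 0, so the identity survives. *)
Lemma shape_weight_dec_prob T :
  shape_weight S T * \rsum_(tb <- decorate S T) dec_prob tb = shape_weight S T.
Proof.
elim/ptree_ind_forall: T => f h; rewrite sum_dec_probE shape_weightE.
have : (\rprod_(c <- f) shape_weight S c) *
  (\rprod_(c <- f) \rsum_(tb <- decorate S c) dec_prob tb) = \rprod_(c <- f) shape_weight S c.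
  rewrite -big_split /=; elim: h => [|T l hT _ IH]; rewrite ?big_nil ?big_cons //.
  by rewrite IH; congr Rmult.
have := omega_kmass (size f); generalize (kmass S (size f) / kmass S (size f)) => x om hD.
by rewrite -[X in _ = X * _]om -[X in _ = _ * X]hD; ring.
Qed.

Lemma shape_weight_ge0 T : 0 <= shape_weight S T.
Proof.
elim/ptree_ind_forall: T => f h; rewrite shape_weightE.
apply: Rmult_le_pos; first exact: omega_ge0.
elim: h => [|T l hT _ IH]; rewrite ?big_nil ?big_cons; [lra|exact: Rmult_le_pos].
Qed.

Section TrimLaw.
Variable B : nat.
Let T : {poly R} := (\poly_(i < B.+1) Zn S i)%R.

(* Up to degree [B], the generating function by size of the enriched trees whose trimming
   at height [k] is [t]; see [sum_trim_mass]. *)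
Fixpoint trim_gf k (t : ttree) : {poly R} :=
  match k, t with
  | 0, Cut => T
  | k'.+1, DNode d a ch =>
      if size ch == d then
        ((omega S d * (sp_weight a / kmass S d)) *: 'X * \prod_(c <- ch) trim_gf k' c)%R
      else 0%R
  | _, _ => 0%R
  end.

Lemma sum_plane_treesS n (h : ptree -> R) : \rsum_(T <- plane_trees n.+1) h T =
  \rsum_(d <- iota 0 n.+1) \rsum_(f <- forests plane_trees d n) h (PNode f).
Proof. by rewrite plane_treesS big_allpairs_dep. Qed.

Lemma big_seq_In A (l : seq A) (f g : A -> R) : (forall x, List.In x l -> f x = g x) ->
  \rsum_(x <- l) f x = \rsum_(x <- l) g x.
Proof.
elim: l => [|x l IH] h; rewrite ?big_nil ?big_cons //.
by rewrite (h x) ?IH //=; [move=> y yl; apply: h; right|left].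
Qed.

Lemma Zn_poly n : (n <= B)%N -> Zn S n = T`_n.
Proof. by move=> nB; rewrite coef_poly ltnS nB. Qed.

(** The functional equation of plane trees, root against forest of subtrees, in the form required of
    [f] for Lagrange inversion. *)
Lemma Zn_recursion n : (n < B)%N ->
  Zn S n.+1 = (\sum_(d < B.+1) omega S d * (T ^+ d)%R`_n)%R.
Proof.
move=> nB; rewrite /Zn rsumE sum_plane_treesS.
transitivity (\rsum_(d < n.+1) (omega S d * (T ^+ d)%R`_n)).
  rewrite -(val_enum_ord n.+1) big_map big_enum /=; apply: eq_bigr => d _.
  (* [sum_forests] speaks of a product over a list of children; a power is the product over [d]
     dummy children. *)
  have -> : ((T ^+ d)%R : {poly R}) = (\prod_(c <- nseq d tt) T)%R.
    by rewrite big_nseq iter_mulr_1.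
  rewrite -(@sum_forests plane_trees _ (fun T _ => shape_weight S T)) //; last first.
    by move=> i _ ib; rewrite -Zn_poly ?/Zn ?rsumE //; lia.
  rewrite size_nseq big_distrr; apply: big_seq_In => f /size_forests sf.
  rewrite shape_weightE sf /=; congr Rmult.
  elim: f {nB} (nat_of_ord d) sf => [|t f IH] [|k] //=; rewrite ?big_nil ?big_cons //.
  by case=> /IH ->.
have nB1 : (n.+1 <= B.+1)%N by lia.
rewrite (big_ord_widen _ (fun d => omega S d * (T ^+ d)%R`_n) nB1) big_mkcond.
apply: eq_bigr => d _; case: ltnP => // h.
by rewrite coef_exp_lt ?GRing.mulr0 ?/Zn // rsumE big_nil.
Qed.

Lemma sum_trim_mass k n t : (n <= B)%N ->
  \rsum_(T <- plane_trees n) (shape_weight S T * trim_mass k T t) = (trim_gf k t)`_n.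
Proof.
elim: k n t => [|k IH] n [|d a ch] nB.
- rewrite /= -Zn_poly // /Zn rsumE; apply: eq_bigr => T0 _.
  rewrite -[RHS]shape_weight_dec_prob; congr Rmult; apply: eq_bigr => tb _.
  by rewrite indicator_true ?Rmult_1_r.
- rewrite coef0 big1 // => -[f] _; rewrite /trim_mass big1 ?Rmult_0_r // => tb _.
  by rewrite indicator_false ?Rmult_0_r.
- rewrite coef0 big1 // => -[f] _; rewrite /trim_mass decorateE big_allpairs_dep.
  rewrite big1 ?Rmult_0_r // => x _; rewrite big1 // => y _.
  by rewrite indicator_false ?Rmult_0_r.
rewrite /=; case: eqP => [e|ne]; last first.
  rewrite coef0 big1 // => -[f] _; rewrite trim_mass_node; case: eqP => e; last by ring.
  by rewrite prod2_size; [ring|rewrite e; exact: nesym].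
subst d; rewrite -GRing.scalerAl coefZ coefXM.
case: n nB => [|n] nB; first by rewrite big_nil GRing.mulr0.
rewrite /= sum_plane_treesS -(@sum_forests plane_trees _
  (fun T t => shape_weight S T * trim_mass k T t)) //; last first.
  by move=> i c ib; apply: IH; lia.
have term d : \rsum_(f <- forests plane_trees d n)
    (shape_weight S (PNode f) * trim_mass k.+1 (PNode f) (DNode a ch)) =
  if d == size ch then omega S (size ch) * (sp_weight a / kmass S (size ch)) *
   \rsum_(f <- forests plane_trees (size ch) n)
      (prod2 (fun T t => shape_weight S T * trim_mass k T t) f ch) else 0.
  case: eqP => [->|ne]; last first.
    rewrite (@big_seq_In _ _ _ (fun=> 0)) ?big1 // => f /size_forests sf.
    by rewrite trim_mass_node sf; case: eqP => //; rewrite Rmult_0_r.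
  rewrite big_distrr; apply: big_seq_In => f /size_forests sf.
  by rewrite trim_mass_node sf eqxx shape_weightE sf /= prod2_mull //; ring.
rewrite (eq_bigr _ (fun d _ => term d)) -big_mkcond.
have [h|h] := ltnP (size ch) n.+1; last first.
  by rewrite (forests_gt _ h) big_nil GRing.mulr0 big1 // => d _; rewrite Rmult_0_r.
rewrite big_const_seq -/(count_mem (size ch) _) count_uniq_mem ?iota_uniq //.
by rewrite mem_iota h /= Rplus_0_r.
Qed.
End TrimLaw.

End TreeSums.

HB.instance Definition _ (S : wspecies) := gen_eqMixin (ttree S).

(** * Probabilities of trimmed trees: spine, exponential tilting, finite enumeration *)

Section TreeLaws.
Variable S : wspecies.
Local Notation ttree := (ttree S).

Fixpoint leaves (t : ttree) : nat :=
  match t with Cut => 1 | DNode _ _ ch => sumn (map leaves ch) end.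

Fixpoint nodes (t : ttree) : nat :=
  match t with Cut => 0 | DNode _ _ ch => (sumn (map nodes ch)).+1 end.

Lemma lawN_node pi k d (a : sp_struct S d) ch : size ch = d ->
  lawN S pi k.+1 (DNode a ch) =
  pi d * (sp_weight a / kmass S d) * \rprod_(c <- ch) lawN S pi k c.
Proof. by move=> e; rewrite /= e eqxx rprodE. Qed.

(** The spine ends in one of the [leaves t] cut vertices. Along it each special vertex contributes
    [d * pi d] for its outdegree and [1 / d] for the choice of the special child; the factors [d]
    cancel, so every endpoint contributes [lawN]. *)
Lemma lawS_lawN pi k t : lawS S pi k t = INR (leaves t) * lawN S pi k t.
Proof.
elim: k t => [|k IH] [|d a ch]; rewrite ?Rmult_1_l ?Rmult_0_r //.
rewrite [lawS _ _ _ _]/=; case: (eqVneq (size ch) d) => [e|ne]; last first.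
  by rewrite /= (negbTE ne) Rmult_0_r.
rewrite lawN_node // rsumE.
have term j : j \in iota 0 d -> / INR d * lawS S pi k (nth (Cut S) ch j) *
    rprod [seq lawN S pi k (nth (Cut S) ch i) | i <- iota 0 d & i != j] =
    INR (leaves (nth (Cut S) ch j)) * (/ INR d * \rprod_(c <- ch) lawN S pi k c).
  move=> jd; rewrite IH rprodE big_filter (big_nth (Cut S)) e /index_iota subn0.
  rewrite [in RHS](bigD1_seq j) ?iota_uniq //=. ring.
rewrite big_seq (eq_bigr _ term) -big_seq -big_distrl /=.
have -> : \rsum_(i <- iota 0 d) INR (leaves (nth (Cut S) ch i)) = INR (sumn (map leaves ch)).
  transitivity (\rsum_(c <- ch) INR (leaves c)).
    by rewrite (big_nth (Cut S)) e /index_iota subn0.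
  by elim: (ch) => [|c l IHl]; rewrite ?big_nil ?big_cons //= IHl -plus_INR.
(* Without children the cancellation of [d] fails, but there is no cut vertex either and both sides
   are 0. *)
have [d0|d0] := posnP d.
  by rewrite (size0nil (etrans e d0)) /=; ring.
by generalize (sp_weight a / kmass S d) => x; field; apply/not_0_INR/eqP; rewrite -lt0n.
Qed.

Lemma lawN_ge0 pi k t : (forall d, 0 <= pi d) -> 0 <= lawN S pi k t.
Proof.
move=> pi0; elim: k t => [|k IH] [|d a ch] /=; try lra.
case: eqP => _; last lra; rewrite rprodE; apply: Rmult_le_pos.
  by apply: Rmult_le_pos => //; exact: ratio_kmass_ge0.
by elim/big_rec: _ => [|c y _ y0]; [lra|apply: Rmult_le_pos].
Qed.

Section TrimGf.
Variables (B : nat) (tau Phi : R).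
Hypothesis Phi0 : Phi <> 0.
Let T : {poly R} := (\poly_(i < B.+1) Zn S i)%R.

Lemma scalerM (a b : R) (p q : {poly R}) :
  ((a * b) *: (p * q) = (a *: p) * (b *: q))%R.
Proof. by rewrite -GRing.scalerAl -GRing.scalerAr GRing.scalerA. Qed.

(** Each decorated vertex yields ['X], each cut vertex an arbitrary tree, hence [T]. Passing from
    [omega] to [pi] costs [Phi] per decorated vertex and [tau] per edge; there are
    [nodes t + leaves t - 1] edges, and the extra [tau] on the right avoids the subtraction. *)
Lemma trim_gf_lawN k t :
  ((tau ^+ (nodes t + leaves t)) *: trim_gf B k t =
   (tau * lawN S (pi_tau S tau Phi) k t * Phi ^+ (nodes t)) *: ('X^(nodes t) * T ^+ leaves t))%R.
Proof.
set pi := pi_tau S tau Phi.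
elim: k t => [|k IH] [|d a ch].
- by rewrite /= GRing.expr1 !GRing.expr0 !GRing.mulr1 GRing.mul1r.
- by rewrite /= GRing.scaler0 GRing.mulr0 GRing.mul0r GRing.scale0r.
- by rewrite /= GRing.scaler0 GRing.mulr0 GRing.mul0r GRing.scale0r.
case: (eqVneq (size ch) d) => [e|ne]; last first.
  by rewrite /= (negbTE ne) GRing.scaler0 GRing.mulr0 GRing.mul0r GRing.scale0r.
rewrite lawN_node // [trim_gf _ _ _]/= e eqxx [nodes _]/= [leaves _]/=.
have IHl : (tau ^+ (sumn (map nodes ch) + sumn (map leaves ch)) *: \prod_(c <- ch) trim_gf B k c =
  (tau ^+ size ch * \prod_(c <- ch) lawN S pi k c * Phi ^+ sumn (map nodes ch)) *:
   ('X^(sumn (map nodes ch)) * T ^+ sumn (map leaves ch)))%R.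
  elim: (ch) => [|c l IHl] /=; first by rewrite !big_nil !GRing.expr0 !GRing.mulr1.
  rewrite !big_cons addnACA GRing.exprD scalerM IH IHl -scalerM.
  congr (_ *: _)%R.
    by rewrite GRing.mulrACA [X in (X * _)%R]GRing.mulrACA GRing.exprS GRing.exprD.
  by rewrite GRing.mulrACA !GRing.exprD.
rewrite addSn GRing.exprS [LHS]scalerM IHl GRing.scalerA -scalerM.
congr (_ *: _)%R; last by rewrite GRing.exprS GRing.mulrA.
rewrite GRing.exprS e -!RpowE.
have key q l x w : tau * (w * q) * (tau ^ d * l * x) = tau * (tau ^ d * w / Phi * q * l) * (Phi * x).
  by field.
exact: (key (sp_weight a / kmass S d) (\rprod_(c <- ch) lawN S pi k c)
  (Phi ^ sumn (map nodes ch)) (omega S d)).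
Qed.

Lemma coef_trim_gf k t n : (nodes t <= n)%N ->
  tau ^ (nodes t + leaves t) * (trim_gf B k t)`_n =
  tau * lawN S (pi_tau S tau Phi) k t * Phi ^ nodes t * ((T ^+ leaves t)%R)`_(n - nodes t).
Proof.
move=> mn; rewrite !RpowE.
have := congr1 (fun p : {poly R} => p`_n) (trim_gf_lawN k t).
by rewrite !coefZ coefXnM ltnNge mn.
Qed.
End TrimGf.

Lemma law_Tn_trim_gf B k n t : (n <= B)%N ->
  law_Tn S k n t = (trim_gf B k t)`_n / Zn S n.
Proof.
move=> nB; rewrite /law_Tn rsumE -sum_trim_mass // /Rdiv big_distrl.
by apply: eq_bigr => T _ /=; rewrite rsumE /trim_mass; ring.
Qed.

Lemma rsum_le T (l : seq T) (f g : T -> R) : (forall x, f x <= g x) ->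
  \rsum_(x <- l) f x <= \rsum_(x <- l) g x.
Proof.
move=> fg; elim: l => [|x l IH]; rewrite ?big_nil ?big_cons; [lra|].
by have := fg x; lra.
Qed.

(** Each enriched tree trims to at most one member of [l]. If [Zn S n = 0] the law is identically 0,
    hence an inequality. *)
Lemma sum_law_Tn_le1 k n (l : seq ttree) : uniq l -> \rsum_(t <- l) law_Tn S k n t <= 1.
Proof.
move=> ul; rewrite /law_Tn.
have -> : \rsum_(t <- l) rsum (plane_trees n) (fun T => shape_weight S T / Zn S n *
    rsum (decorate S T) (fun tb => dec_prob tb * indicator (trim S k tb = t))) =
  \rsum_(T <- plane_trees n) (shape_weight S T / Zn S n *
    \rsum_(tb <- decorate S T) (dec_prob tb * \rsum_(t <- l) indicator (trim S k tb = t))).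
  under eq_bigr do rewrite rsumE.
  rewrite exchange_big; apply: eq_bigr => T _ /=; rewrite -big_distrr /=; congr Rmult.
  under eq_bigr do rewrite rsumE.
  by rewrite exchange_big; apply: eq_bigr => tb _ /=; rewrite -big_distrr.
have Z0 : 0 <= Zn S n by rewrite /Zn rsumE; apply: rsum_ge0 => T; exact: shape_weight_ge0.
have ind_le t : \rsum_(t' <- l) indicator (t = t') <= 1.
  have [tl|tl] := boolP (t \in l); last first.
    rewrite big_seq big1; first lra.
    by move=> i il; rewrite indicator_false // => e; move: tl; rewrite e il.
  rewrite (bigD1_seq t) //= big1 ?indicator_true //; first lra.
  by move=> i /eqP ne; rewrite indicator_false // => e; apply: ne.
apply: (@Rle_trans _ (\rsum_(T <- plane_trees n) (shape_weight S T / Zn S n))).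
  apply: rsum_le => T.
  have h0 : 0 <= shape_weight S T / Zn S n.
    have [->|zn] := Req_dec (Zn S n) 0; first by rewrite /Rdiv Rinv_0; lra.
    apply: Rmult_le_pos; first exact: shape_weight_ge0.
    by apply/Rlt_le/Rinv_0_lt_compat; lra.
  rewrite -[X in _ <= X]Rmult_1_r; apply: Rmult_le_compat_l => //.
  apply: Rle_trans (proj2 (sum_dec_prob_le1 S T)); apply: rsum_le => tb.
  by have := dec_prob_ge0 tb; have := ind_le (trim S k tb); nra.
rewrite -big_distrl /= -rsumE -/(Zn S n).
have [->|zn] := Req_dec (Zn S n) 0; first lra.
by rewrite Rinv_r //; lra.
Qed.

Lemma rsum_uniq_le (T : eqType) (l E : seq T) (g : T -> R) : uniq l ->
  (forall t, 0 <= g t) -> (forall t, t \in l -> g t <> 0 -> t \in E) ->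
  \rsum_(t <- l) g t <= \rsum_(t <- E) g t.
Proof.
move=> ul g0; elim: l E ul => [|x l IH] E /=; first by rewrite big_nil => *; exact: rsum_ge0.
move=> /andP [xl ul] h; rewrite big_cons.
have [gx|gx] := Req_dec (g x) 0.
  by rewrite gx Rplus_0_l; apply: IH => // t tl; apply: h; rewrite inE tl orbT.
rewrite (perm_big _ (perm_to_rem (h x (mem_head _ _) gx))) big_cons.
apply: Rplus_le_compat_l; apply: IH => // t tl gt.
have := h t; rewrite inE tl orbT => /(_ erefl gt).
rewrite (perm_mem (perm_to_rem (h x (mem_head _ _) gx))) inE => /orP [/eqP e|//].
by move: xl; rewrite -e tl.
Qed.

Section Enumeration.
Variable D : nat.

(* The possible trimmings at height [k] with all outdegrees at most [D]. *)
Fixpoint trim_enum (k : nat) : seq ttree :=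
  match k with
  | 0 => [:: Cut S]
  | k'.+1 => [seq DNode y.1 y.2 | d <- iota 0 D.+1,
       y <- [seq (a, ch) | a <- enum (sp_struct S d), ch <- lprod (nseq d (trim_enum k'))]]
  end.

Lemma trim_enumS k : trim_enum k.+1 = [seq DNode y.1 y.2 | d <- iota 0 D.+1,
  y <- [seq (a, ch) | a <- enum (sp_struct S d), ch <- lprod (nseq d (trim_enum k))]].
Proof. by []. Qed.

Lemma mem_lprod_nseq (T : eqType) d (E : seq T) ch :
  (ch \in lprod (nseq d E)) = (size ch == d) && all (mem E) ch.
Proof.
elim: d ch => [|d IH] ch; first by rewrite inE; case: ch.
apply/allpairsP/idP => [[[t f] /= [tE]]|].
  by rewrite IH => /andP [/eqP <- h] ->; rewrite /= eqxx tE h.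
case: ch => [|t f] //=; rewrite eqSS => /andP [s /andP [tE h]].
by exists (t, f); split => //=; rewrite IH s h.
Qed.

Lemma uniq_lprod_nseq (T : eqType) d (E : seq T) : uniq E -> uniq (lprod (nseq d E)).
Proof.
move=> uE; elim: d => //= d IH; apply: allpairs_uniq => //.
by move=> [t f] [t' f'] _ _ /= [-> ->].
Qed.

Lemma uniq_trim_enum k : uniq (trim_enum k).
Proof.
elim: k => [|k IH] //; apply: allpairs_uniq_dep; first exact: iota_uniq.
  move=> d _; apply: allpairs_uniq; [exact: enum_uniq|exact: uniq_lprod_nseq|].
  by move=> [a f] [a' f'].
move=> [d [a f]] [d' [a' f']] _ _ /= e; have dd : d = d' by case: e.
by subst d'; case/DNode_inj: e => -> ->.
Qed.

Lemma sum_trim_enumS k (g : ttree -> R) : \rsum_(t <- trim_enum k.+1) g t =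
  \rsum_(d <- iota 0 D.+1) \rsum_(a <- enum (sp_struct S d))
    \rsum_(ch <- lprod (nseq d (trim_enum k))) g (DNode a ch).
Proof.
rewrite trim_enumS big_allpairs_dep; apply: eq_bigr => d _.
by rewrite big_allpairs_dep.
Qed.

Lemma mem_trim_enumS k d (a : sp_struct S d) ch : (d <= D)%N -> size ch = d ->
  all (mem (trim_enum k)) ch -> DNode a ch \in trim_enum k.+1.
Proof.
move=> dD sc h; rewrite trim_enumS; apply/allpairsPdep.
exists d, (a, ch); split => //; first by rewrite mem_iota.
by apply/allpairsP; exists (a, ch); rewrite mem_enum mem_lprod_nseq sc eqxx h.
Qed.

End Enumeration.

(** The threshold is the largest outdegree occurring in [t]. *)
Lemma lawN_neq0_mem pi k t : lawN S pi k t <> 0 ->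
  exists D0, forall D, (D0 <= D)%N -> t \in trim_enum D k.
Proof.
elim: k t => [|k IH] [|d a ch]; [by exists 0%N => D _; exact: mem_head|by case|by case|].
case: (eqVneq (size ch) d) => [e|ne]; last by rewrite /= (negbTE ne).
rewrite lawN_node // => h.
have : \rprod_(c <- ch) lawN S pi k c <> 0 by move=> h0; apply: h; rewrite h0 Rmult_0_r.
move=> {}h; suff [D0 hD] : exists D0, forall D, (D0 <= D)%N -> all (mem (trim_enum D k)) ch.
  exists (maxn D0 d) => D; rewrite geq_max => /andP [h1 h2].
  by apply: mem_trim_enumS => //; apply: hD.
elim: (ch) h => [|c l IHl]; first by exists 0%N.
rewrite big_cons => h.
have [D1 h1] : exists D0, forall D, (D0 <= D)%N -> c \in trim_enum D k.
  by apply: IH => h0; apply: h; rewrite h0 Rmult_0_l.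
have [|D2 h2] := IHl; first by move=> h0; apply: h; rewrite h0 Rmult_0_r.
by exists (maxn D1 D2) => D; rewrite geq_max => /andP [a1 a2] /=; rewrite h1 ?h2.
Qed.

End TreeLaws.

(** * Moments under the modified tree *)

Section ForestSums.
Variables (T : Type) (E : seq T) (N : T -> R).
Hypothesis N0 : forall t, 0 <= N t.

Definition add_fun (u : T -> R) (ch : seq T) := \rsum_(c <- ch) u c.

(** Unnormalised expectation of [H] over [d] independent trees with weights [N]. The total mass [M]
    may be below 1, since [E] will only contain trees of bounded outdegree. *)
Definition forest_sum d (H : seq T -> R) :=
  \rsum_(ch <- lprod (nseq d E)) ((\rprod_(c <- ch) N c) * H ch).

Let M := \rsum_(t <- E) N t.

Lemma forest_sumS_mul d (f : T -> R) (h : seq T -> R) :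
  \rsum_(t <- E) \rsum_(ch <- lprod (nseq d E)) (N t * (\rprod_(c <- ch) N c) * (f t * h ch)) =
  (\rsum_(t <- E) (N t * f t)) * forest_sum d h.
Proof.
rewrite big_distrl; apply: eq_bigr => t _ /=; rewrite /forest_sum big_distrr.
by apply: eq_bigr => ch _ /=; ring.
Qed.

Lemma forest_sumS d H : forest_sum d.+1 H =
  \rsum_(t <- E) \rsum_(ch <- lprod (nseq d E)) (N t * (\rprod_(c <- ch) N c) * H (t :: ch)).
Proof.
rewrite /forest_sum [lprod _]/= big_allpairs_dep; apply: eq_bigr => t _.
by apply: eq_bigr => ch _; rewrite big_cons.
Qed.

Lemma forest_sum0 H : forest_sum 0 H = H [::].
Proof. by rewrite /forest_sum /= big_cons !big_nil; ring. Qed.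

Lemma forest_sum1 d : forest_sum d (fun=> 1) = M ^ d.
Proof.
elim: d => [|d IH]; first by rewrite forest_sum0.
transitivity ((\rsum_(t <- E) (N t * 1)) * forest_sum d (fun=> 1)).
  rewrite -forest_sumS_mul forest_sumS; apply: eq_bigr => t _; apply: eq_bigr => ch _; ring.
by rewrite IH /=; congr Rmult; apply: eq_bigr => t _; ring.
Qed.

Lemma forest_sum_addS d u : forest_sum d.+1 (add_fun u) =
  (\rsum_(t <- E) (N t * u t)) * M ^ d + M * forest_sum d (add_fun u).
Proof.
rewrite forest_sumS -forest_sum1 -forest_sumS_mul.
have -> : M = \rsum_(t <- E) (N t * 1) by apply: eq_bigr => t _; ring.
rewrite -forest_sumS_mul -big_split; apply: eq_bigr => t _ /=.
rewrite -big_split; apply: eq_bigr => ch _ /=; rewrite /add_fun big_cons; ring.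
Qed.

Lemma forest_sum_add d u : forest_sum d (add_fun u) =
  INR d * M ^ (d.-1) * \rsum_(t <- E) (N t * u t).
Proof.
elim: d => [|d IH]; first by rewrite forest_sum0 /add_fun big_nil /=; ring.
rewrite forest_sum_addS IH S_INR [d.+1.-1]/=; case: d {IH} => [|d]; first by rewrite /=; ring.
by rewrite [_.+1.-1]/= -tech_pow_Rmult; ring.
Qed.

Lemma forest_sum_add2S d u v :
  forest_sum d.+1 (fun ch => add_fun v ch * add_fun u ch) =
  (\rsum_(t <- E) (N t * (v t * u t))) * M ^ d +
  (\rsum_(t <- E) (N t * v t)) * forest_sum d (add_fun u) +
  (\rsum_(t <- E) (N t * u t)) * forest_sum d (add_fun v) +
  M * forest_sum d (fun ch => add_fun v ch * add_fun u ch).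
Proof.
rewrite forest_sumS -forest_sum1.
have -> : M = \rsum_(t <- E) (N t * 1) by apply: eq_bigr => t _; ring.
rewrite -!forest_sumS_mul -!big_split; apply: eq_bigr => t _ /=.
rewrite -!big_split; apply: eq_bigr => ch _ /=; rewrite /add_fun !big_cons; ring.
Qed.

Hypothesis M1 : M <= 1.

Lemma mass_ge0 : 0 <= M. Proof. exact: rsum_ge0. Qed.

Lemma mass_pow d : 0 <= M ^ d <= 1.
Proof.
have := mass_ge0; split; first exact: pow_le.
by rewrite -(pow1 d); apply: pow_incr.
Qed.

Lemma forest_sum_add_ge0 d u : (forall t, 0 <= u t) ->
  0 <= forest_sum d (add_fun u) <= INR d * \rsum_(t <- E) (N t * u t).
Proof.
move=> u0; rewrite forest_sum_add.
have h : 0 <= \rsum_(t <- E) (N t * u t) by apply: rsum_ge0 => t; apply: Rmult_le_pos.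
have [h1 h2] := mass_pow d.-1; have hd := pos_INR d; split.
  by apply: Rmult_le_pos => //; apply: Rmult_le_pos.
by apply: Rmult_le_compat_r => //; nra.
Qed.

(** The product of the two sums has [d] diagonal terms and [d * (d - 1)] terms from distinct
    independent trees; the remaining trees contribute powers of [M], at most 1. *)
Lemma forest_sum_add2_le d u v : (forall t, 0 <= u t) -> (forall t, 0 <= v t) ->
  0 <= forest_sum d (fun ch => add_fun v ch * add_fun u ch) <=
  INR d * (\rsum_(t <- E) (N t * (v t * u t))) +
  INR d * (INR d - 1) * ((\rsum_(t <- E) (N t * v t)) * (\rsum_(t <- E) (N t * u t))).
Proof.
move=> u0 v0; elim: d => [|d IH].
  by rewrite forest_sum0 /add_fun !big_nil /=; lra.
have hu := forest_sum_add_ge0 d u0; have hv := forest_sum_add_ge0 d v0.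
have hd := pos_INR d; have [p0 p1] := mass_pow d; have m0 := mass_ge0.
rewrite forest_sum_add2S S_INR; move: hu hv IH.
have : 0 <= \rsum_(t <- E) (N t * v t) by apply: rsum_ge0 => t; apply: Rmult_le_pos.
have : 0 <= \rsum_(t <- E) (N t * u t) by apply: rsum_ge0 => t; apply: Rmult_le_pos.
have : 0 <= \rsum_(t <- E) (N t * (v t * u t)).
  by apply: rsum_ge0 => t; apply: Rmult_le_pos => //; apply: Rmult_le_pos.
move: (\rsum_(t <- E) (N t * v t)) (\rsum_(t <- E) (N t * u t)) (\rsum_(t <- E) (N t * (v t * u t)))
  (forest_sum d (add_fun u)) (forest_sum d (add_fun v))
  (forest_sum d (fun ch => add_fun v ch * add_fun u ch)) (M ^ d) p0 p1 => A U Bm fu fv W P p0 p1 B0 U0 A0.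
move=> [fu0 fu1] [fv0 fv1] [W0 W1]; split.
  have a1 := Rmult_le_pos _ _ B0 p0; have a2 := Rmult_le_pos _ _ A0 fu0.
  have a3 := Rmult_le_pos _ _ U0 fv0; have a4 := Rmult_le_pos _ _ m0 W0; lra.
have e1 : Bm * P <= Bm by nra.
have e2 : A * fu <= A * (INR d * U) by apply: Rmult_le_compat_l.
have e3 : U * fv <= U * (INR d * A) by apply: Rmult_le_compat_l.
have e4 : M * W <= W by nra.
nra.
Qed.

End ForestSums.

(** * Moments of the numbers of cut and decorated vertices, by recursion on the height *)

Section Moments.
Variables (S : wspecies) (pi : nat -> R) (s alpha beta : R).
Local Notation ttree := (ttree S).
Hypothesis pi0 : forall d, 0 <= pi d.
Hypothesis pi_kmass : forall d, pi d * (kmass S d / kmass S d) = pi d.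
Hypothesis sum_pi : forall D, \rsum_(d <- iota 0 D.+1) pi d <= 1.
Hypothesis sum_pi1 : forall D, \rsum_(d <- iota 0 D.+1) (INR d * pi d) <= 1.
Hypothesis sum_pi2 : forall D, \rsum_(d <- iota 0 D.+1) (INR d * (INR d - 1) * pi d) <= s.
Hypothesis sum_pi_lim : forall eta, 0 < eta -> exists D0, forall D, (D0 <= D)%N ->
  1 - eta <= \rsum_(d <- iota 0 D.+1) pi d /\
  1 - eta <= \rsum_(d <- iota 0 D.+1) (INR d * pi d).
Hypotheses (alpha0 : 0 <= alpha) (beta0 : 0 <= beta).

Definition Lv (t : ttree) := INR (leaves t).
(* With small weights [alpha] and [beta], one application of Markov's inequality bounds
   both statistics. *)
Definition size_fun (t : ttree) := alpha * Lv t + beta * INR (nodes t).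

Lemma s_ge0 : 0 <= s.
Proof.
have := sum_pi2 0; rewrite /= big_cons big_nil /=; lra.
Qed.

Lemma Lv_ge0 t : 0 <= Lv t. Proof. exact: pos_INR. Qed.

Lemma size_fun_ge0 t : 0 <= size_fun t.
Proof.
have h1 := Lv_ge0 t; have h2 := pos_INR (nodes t); rewrite /size_fun; nra.
Qed.

Lemma Lv_node d (a : sp_struct S d) ch : Lv (DNode a ch) = add_fun Lv ch.
Proof.
rewrite /Lv /add_fun /=; elim: ch => [|c l IH]; rewrite ?big_nil ?big_cons //=.
by rewrite -plusE plus_INR IH.
Qed.

Lemma size_fun_node d (a : sp_struct S d) ch :
  size_fun (DNode a ch) = beta + add_fun size_fun ch.
Proof.
have nodesE : INR (nodes (DNode a ch)) = 1 + add_fun (fun t => INR (nodes t)) ch.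
  rewrite [nodes _]/= S_INR Rplus_comm; congr Rplus; rewrite /add_fun.
  elim: ch => [|c l IH]; rewrite ?big_nil ?big_cons //=.
  by rewrite -plusE plus_INR IH.
rewrite /size_fun nodesE Lv_node /add_fun Rmult_plus_distr_l !big_distrr /=.
rewrite -Rplus_assoc [_ + beta * 1]Rplus_comm Rmult_1_r Rplus_assoc; congr Rplus.
by rewrite big_split.
Qed.

Section FixD.
Variable D : nat.
Local Notation E := (trim_enum S D).
Definition lsum k (F : ttree -> R) := \rsum_(t <- E k) (lawN S pi k t * F t).

(** The branching property: condition on the outdegree of the root. The decoration of the root sums
    out by [pi_kmass]. *)
Lemma lsumS k F H : (forall d (a : sp_struct S d) ch, F (DNode a ch) = H ch) ->
  lsum k.+1 F = \rsum_(d <- iota 0 D.+1) (pi d * forest_sum (E k) (lawN S pi k) d H).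
Proof.
move=> FH; rewrite /lsum sum_trim_enumS; apply: eq_bigr => d _.
have -> : pi d * forest_sum (E k) (lawN S pi k) d H = \rsum_(a <- enum (sp_struct S d))
    (pi d * (sp_weight a / kmass S d) * forest_sum (E k) (lawN S pi k) d H).
  rewrite -big_distrl -big_distrr /=; congr Rmult.
  by rewrite /Rdiv -big_distrl /= -kmass_eq pi_kmass.
apply: eq_bigr => a _; rewrite big_distrr big_seq [in RHS]big_seq.
apply: eq_bigr => ch; rewrite mem_lprod_nseq => /andP [/eqP sc _].
rewrite lawN_node // FH /=; ring.
Qed.

Definition mass k := \rsum_(t <- E k) lawN S pi k t.

Lemma massE k : mass k = lsum k (fun=> 1).
Proof. by rewrite /mass /lsum; apply: eq_bigr => t _; ring. Qed.

Lemma rsum_pi_le (f g : nat -> R) : (forall d, f d <= g d) ->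
  \rsum_(d <- iota 0 D.+1) (pi d * f d) <= \rsum_(d <- iota 0 D.+1) (pi d * g d).
Proof. by move=> fg; apply: rsum_le => d; apply: Rmult_le_compat_l. Qed.

Lemma massS k : mass k.+1 = \rsum_(d <- iota 0 D.+1) (pi d * mass k ^ d).
Proof.
rewrite massE (@lsumS k _ (fun=> 1)) //; apply: eq_bigr => d _.
by rewrite forest_sum1.
Qed.

Lemma lawN0 k t : 0 <= lawN S pi k t. Proof. exact: lawN_ge0. Qed.

Lemma mass_bounds k : 0 <= mass k <= 1.
Proof.
elim: k => [|k IH]; first by rewrite /mass /= big_cons big_nil /=; lra.
split; first by apply: rsum_ge0; exact: lawN0.
rewrite massS; apply: Rle_trans (sum_pi D); apply: rsum_le => d.
have : mass k ^ d <= 1 by rewrite -(pow1 d); apply: pow_incr.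
by have := pi0 d; nra.
Qed.

Lemma lsum0 F : lsum 0 F = F (Cut S).
Proof. by rewrite /lsum /= big_cons big_nil /=; ring. Qed.

Lemma lsum_ge0 k F : (forall t, 0 <= F t) -> 0 <= lsum k F.
Proof. by move=> F0; apply: rsum_ge0 => t; apply: Rmult_le_pos => //; exact: lawN0. Qed.

Lemma lsum_LvS k : lsum k.+1 Lv =
  (\rsum_(d <- iota 0 D.+1) (pi d * (INR d * mass k ^ d.-1))) * lsum k Lv.
Proof.
rewrite (@lsumS k _ (add_fun Lv)); last exact: Lv_node.
by rewrite big_distrl; apply: eq_bigr => d _ /=; rewrite forest_sum_add /lsum /mass; ring.
Qed.

(** Generation [k] of a critical process has mean size 1, and the cap on outdegrees only lowers it.
    By [lawS_lawN] this is also the mass of the modified law on [E k]. *)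
Lemma lsum_Lv_le1 k : lsum k Lv <= 1.
Proof.
elim: k => [|k IH]; first by rewrite lsum0 /Lv /=; lra.
rewrite lsum_LvS.
have h0 := lsum_ge0 k Lv_ge0.
suff : 0 <= \rsum_(d <- iota 0 D.+1) (pi d * (INR d * mass k ^ d.-1)) <= 1 by nra.
have hm d : 0 <= mass k ^ d <= 1.
  have := mass_bounds k => -[m0 m1]; split; first exact: pow_le.
  by rewrite -(pow1 d); apply: pow_incr.
split.
  apply: rsum_ge0 => d; apply: Rmult_le_pos => //; apply: Rmult_le_pos; first exact: pos_INR.
  by have := hm d.-1; lra.
apply: Rle_trans (sum_pi1 D); apply: rsum_le => d.
have := hm d.-1; have := pi0 d; have := pos_INR d => h1 h2 h3.
have : 0 <= pi d * INR d by apply: Rmult_le_pos.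
nra.
Qed.

(** The cut vertices form generation [k] and the decorated ones generations 0 to [k - 1], each of
    mean at most 1. *)
Lemma lsum_size_le k : lsum k size_fun <= alpha + beta * INR k.
Proof.
elim: k => [|k IH]; first by rewrite lsum0 /size_fun /Lv /=; lra.
rewrite (@lsumS k _ (fun ch => beta * 1 + add_fun size_fun ch)); last first.
  by move=> d a ch; rewrite size_fun_node; ring.
have term d : forest_sum (E k) (lawN S pi k) d (fun ch => beta * 1 + add_fun size_fun ch) <=
   beta + INR d * lsum k size_fun.
  have -> : forest_sum (E k) (lawN S pi k) d (fun ch => beta * 1 + add_fun size_fun ch) =
     beta * forest_sum (E k) (lawN S pi k) d (fun=> 1) +
     forest_sum (E k) (lawN S pi k) d (add_fun size_fun).
    rewrite /forest_sum big_distrr -big_split; apply: eq_bigr => ch _ /=; ring.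
  have [_ h1] := forest_sum_add_ge0 (@lawN0 k) (proj2 (mass_bounds k)) d size_fun_ge0.
  rewrite forest_sum1; have := mass_pow (@lawN0 k) (proj2 (mass_bounds k)) d => h2.
  apply: Rplus_le_compat => //; nra.
apply: Rle_trans (rsum_pi_le term) _.
have -> : \rsum_(d <- iota 0 D.+1) (pi d * (beta + INR d * lsum k size_fun)) =
  beta * (\rsum_(d <- iota 0 D.+1) pi d) +
  (\rsum_(d <- iota 0 D.+1) (INR d * pi d)) * lsum k size_fun.
  rewrite big_distrr big_distrl -big_split; apply: eq_bigr => d _ /=; ring.
have := sum_pi D; have := sum_pi1 D; have := lsum_ge0 k size_fun_ge0.
by rewrite S_INR; nra.
Qed.

(** Because of the weight [Lv], this bounds the mean of [size_fun] under the modified tree. One more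
    generation adds at most [beta] for the root and, from pairs of distinct children, the second
    factorial moment [s] times the mean bounded by [lsum_size_le]. *)
Lemma lsum_Lv_size_le k : lsum k (fun t => Lv t * size_fun t) <=
  alpha + INR k * (beta + s * (alpha + beta * INR k)).
Proof.
elim: k => [|k IH]; first by rewrite lsum0 /size_fun /Lv /=; lra.
rewrite (@lsumS k _ (fun ch => beta * add_fun Lv ch + add_fun Lv ch * add_fun size_fun ch)); last first.
  by move=> d a ch; rewrite size_fun_node Lv_node; ring.
have A0 := lsum_ge0 k Lv_ge0; have U0 := lsum_ge0 k size_fun_ge0.
have A1 := lsum_Lv_le1 k; have U1 := lsum_size_le k.
have W0 : 0 <= lsum k (fun t => Lv t * size_fun t).
  by apply: lsum_ge0 => t; apply: Rmult_le_pos; [exact: Lv_ge0|exact: size_fun_ge0].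
have term d : forest_sum (E k) (lawN S pi k) d
     (fun ch => beta * add_fun Lv ch + add_fun Lv ch * add_fun size_fun ch) <=
   INR d * (beta + lsum k (fun t => Lv t * size_fun t)) +
   INR d * (INR d - 1) * lsum k size_fun.
  have -> : forest_sum (E k) (lawN S pi k) d
     (fun ch => beta * add_fun Lv ch + add_fun Lv ch * add_fun size_fun ch) =
     beta * forest_sum (E k) (lawN S pi k) d (add_fun Lv) +
     forest_sum (E k) (lawN S pi k) d (fun ch => add_fun Lv ch * add_fun size_fun ch).
    rewrite /forest_sum big_distrr -big_split; apply: eq_bigr => ch _ /=; ring.
  have [_ h1] := forest_sum_add_ge0 (@lawN0 k) (proj2 (mass_bounds k)) d Lv_ge0.
  have [_ h2] := forest_sum_add2_le (@lawN0 k) (proj2 (mass_bounds k)) d size_fun_ge0 Lv_ge0.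
  rewrite -/(lsum k Lv) -/(lsum k size_fun) -/(lsum k (fun t => Lv t * size_fun t)) in h1 h2.
  have hd := pos_INR d.
  have dd : 0 <= INR d * (INR d - 1).
    by case: (d) => [|e]; rewrite ?S_INR /=; [lra|have := pos_INR e; nra].
  have e1 : beta * forest_sum (E k) (lawN S pi k) d (add_fun Lv) <= beta * INR d.
    by apply: Rmult_le_compat_l => //; nra.
  have e2 : INR d * (INR d - 1) * (lsum k Lv * lsum k size_fun) <=
     INR d * (INR d - 1) * lsum k size_fun by apply: Rmult_le_compat_l => //; nra.
  lra.
apply: Rle_trans (rsum_pi_le term) _.
have -> : \rsum_(d <- iota 0 D.+1) (pi d * (INR d * (beta + lsum k (fun t => Lv t * size_fun t)) +
   INR d * (INR d - 1) * lsum k size_fun)) =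
  (\rsum_(d <- iota 0 D.+1) (INR d * pi d)) * (beta + lsum k (fun t => Lv t * size_fun t)) +
  (\rsum_(d <- iota 0 D.+1) (INR d * (INR d - 1) * pi d)) * lsum k size_fun.
  rewrite !big_distrl -big_split; apply: eq_bigr => d _ /=; ring.
have h1 := sum_pi1 D; have h2 := sum_pi2 D; have s0 := s_ge0; have k0 := pos_INR k.
have e1 : (\rsum_(d <- iota 0 D.+1) (INR d * pi d)) * (beta + lsum k (fun t => Lv t * size_fun t))
  <= 1 * (beta + lsum k (fun t => Lv t * size_fun t)) by apply: Rmult_le_compat_r => //; lra.
have e2 : (\rsum_(d <- iota 0 D.+1) (INR d * (INR d - 1) * pi d)) * lsum k size_fun
  <= s * (alpha + beta * INR k).
  apply: Rle_trans (Rmult_le_compat_r _ _ _ U0 h2) _; exact: Rmult_le_compat_l.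
have e3 : 0 <= (INR k + 1) * (s * beta).
  by apply: Rmult_le_pos; [lra|exact: Rmult_le_pos].
rewrite S_INR; nra.
Qed.

End FixD.

(** For fixed [k] the enumeration exhausts both the Galton-Watson law and its size-biased version as
    the cap [D] grows, so no mass of the modified tree escapes to infinity. *)
Lemma lsum_Lv_lim k eta : 0 < eta -> exists D0, forall D, (D0 <= D)%N ->
  1 - eta <= mass D k /\ 1 - eta <= lsum D k Lv.
Proof.
elim: k eta => [|k IH] eta eta0.
  exists 0%N => D _; rewrite lsum0 /Lv /mass /= big_cons big_nil /=; lra.
(* One generation turns the error [e] into at most [(3 + s) * e]; the minimum with 1 keeps
   [1 - (2 + s) * e] nonnegative. *)
have s0 := s_ge0; set e := Rmin eta 1 / (3 + s).
have e0 : 0 < e by apply: Rdiv_lt_0_compat; [apply: Rmin_pos; lra|lra].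
have es : e * (3 + s) <= eta /\ e * (3 + s) <= 1.
  have -> : e * (3 + s) = Rmin eta 1 by rewrite /e; field; lra.
  by split; [exact: Rmin_l|exact: Rmin_r].
have [D1 h1] := IH e e0; have [D2 h2] := sum_pi_lim e0.
exists (maxn D1 D2) => D; rewrite geq_max => /andP [/h1 [m a] /h2 [p q]].
have [m0 m1] := mass_bounds D k.
(* Bernoulli's inequality linearises the powers of the defective mass, so that only the first two
   moments of [pi] appear. *)
have bern d : 1 - INR d * (1 - mass D k) <= mass D k ^ d.
  elim: d => [|d IHd]; first by rewrite /=; lra.
  rewrite S_INR -tech_pow_Rmult.
  have e1 : mass D k * (1 - INR d * (1 - mass D k)) <= mass D k * mass D k ^ d.
    exact: Rmult_le_compat_l.
  have e2 : 0 <= INR d * ((1 - mass D k) * (1 - mass D k)).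
    by apply: Rmult_le_pos; [exact: pos_INR|apply: Rmult_le_pos; lra].
  lra.
split.
  rewrite massS; apply: Rle_trans (rsum_pi_le D bern).
  have -> : \rsum_(d <- iota 0 D.+1) (pi d * (1 - INR d * (1 - mass D k))) =
    (\rsum_(d <- iota 0 D.+1) pi d) - (1 - mass D k) * (\rsum_(d <- iota 0 D.+1) (INR d * pi d)).
    have -> x y z : x - y * z = x + (- y) * z by move=> *; ring.
    rewrite big_distrr -big_split; apply: eq_bigr => d _ /=; ring.
  have e1 : (1 - mass D k) * (\rsum_(d <- iota 0 D.+1) (INR d * pi d)) <= (1 - mass D k) * 1.
    by apply: Rmult_le_compat_l; [lra|exact: sum_pi1].
  have e2 : 0 <= e * s by apply: Rmult_le_pos; lra.
  lra.
rewrite lsum_LvS; have A1 := lsum_Lv_le1 D k.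
have : 1 - (2 + s) * e <= \rsum_(d <- iota 0 D.+1) (pi d * (INR d * mass D k ^ d.-1)).
  apply: (@Rle_trans _ (\rsum_(d <- iota 0 D.+1) (pi d * (INR d - INR d * (INR d - 1) * (1 - mass D k))))).
    have -> : \rsum_(d <- iota 0 D.+1) (pi d * (INR d - INR d * (INR d - 1) * (1 - mass D k))) =
      (\rsum_(d <- iota 0 D.+1) (INR d * pi d)) -
      (1 - mass D k) * (\rsum_(d <- iota 0 D.+1) (INR d * (INR d - 1) * pi d)).
      have -> x y z : x - y * z = x + (- y) * z by move=> *; ring.
      rewrite big_distrr -big_split; apply: eq_bigr => d _ /=; ring.
    have e1 : (1 - mass D k) * (\rsum_(d <- iota 0 D.+1) (INR d * (INR d - 1) * pi d)) <= (1 - mass D k) * s.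
      by apply: Rmult_le_compat_l; [lra|exact: sum_pi2].
    have e2 : (1 - mass D k) * s <= e * s by apply: Rmult_le_compat_r; lra.
    lra.
  apply: rsum_pi_le => -[|d]; first by rewrite /=; lra.
  rewrite [_.+1.-1]/= S_INR; have := bern d; have := pos_INR d; nra.
move: (\rsum_(d <- iota 0 D.+1) _) => X hX.
have se : 0 <= s * e by apply: Rmult_le_pos; lra.
have e1 : (1 - (2 + s) * e) * lsum D k Lv <= X * lsum D k Lv by apply: Rmult_le_compat_r; lra.
have e2 : (1 - (2 + s) * e) * (1 - e) <= (1 - (2 + s) * e) * lsum D k Lv.
  by apply: Rmult_le_compat_l; lra.
have e3 : 0 <= ((2 + s) * e) * e by apply: Rmult_le_pos; lra.
lra.
Qed.

End Moments.

(** * The local limit theorem *)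

Section Calculus.

Lemma sin_le_id x : 0 <= x -> sin x <= x.
Proof.
by move=> [x0|<-]; [apply/Rlt_le/sin_lt_x|rewrite sin_0; lra].
Qed.

Lemma Rabs_sin_le x : Rabs (sin x) <= Rabs x.
Proof.
have h y : 0 <= y -> Rabs (sin y) <= y.
  move=> y0; apply: Rabs_le; split; last exact: sin_le_id.
  have [y1|y1] := Rle_dec y 1; last by have := SIN_bound y; lra.
  have : 0 <= sin y by (apply: sin_ge_0; have := PI2_1; lra).
  lra.
have [x0|x0] := Rle_dec 0 x; first by rewrite (Rabs_pos_eq x) //; exact: h.
by rewrite -Rabs_Ropp -sin_neg -(Rabs_Ropp x) (Rabs_pos_eq (- x)); [apply: h; lra|lra].
Qed.

Lemma one_sub_cos x : 1 - cos x = 2 * sin (x / 2) ^ 2.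
Proof.
have -> : cos x = cos (2 * (x / 2)) by congr cos; field.
by rewrite cos_2a_sin; ring.
Qed.

Lemma sin_sqr_le x : sin x ^ 2 <= x ^ 2.
Proof.
rewrite -(pow2_abs (sin x)) -(pow2_abs x); apply: pow_incr.
by split; [exact: Rabs_pos|exact: Rabs_sin_le].
Qed.

Lemma sub_sin_le_cube x : 0 <= x -> 0 <= x - sin x <= x ^ 3 / 6.
Proof.
move=> x0; split; first by have := sin_le_id x0; lra.
pose f t := t ^ 3 / 6 - (t - sin t).
have [||c [hc1 hc2]] := MVT_gen f 0 x (fun t => t ^ 2 / 2 - (1 - cos t)).
- by move=> t _; rewrite /f; auto_derive => //; field.
- move=> t _; apply/continuity_pt_filterlim; apply: (@ex_derive_continuous R_AbsRing R_NormedModule).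
  by rewrite /f; auto_derive.
have : 0 <= c ^ 2 / 2 - (1 - cos c).
  by rewrite one_sub_cos; have := sin_sqr_le (c / 2); lra.
move: hc2; rewrite /f sin_0; nra.
Qed.

Lemma sin_ge_third x : 0 <= x <= 2 -> x / 3 <= sin x.
Proof.
move=> [x0 x2]; have [_ h] := sub_sin_le_cube x0.
have : x ^ 3 <= 4 * x by nra.
lra.
Qed.

(** The cubic bound is the sharp one near 0; the quadratic one is all that a law with merely two
    moments can integrate at large arguments. [Taylor_error] uses both. *)
Lemma sin_taylor x : Rabs (sin x - x) <= 2 * x ^ 2 /\ Rabs (sin x - x) <= Rabs x ^ 3.
Proof.
wlog x0 : x / 0 <= x => [h|].
  have [x0|x0] := Rle_dec 0 x; first exact: h.
  have := h (- x); rewrite sin_neg Rabs_Ropp.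
  have -> : - sin x - - x = - (sin x - x) by ring.
  have -> : (- x) ^ 2 = x ^ 2 by ring.
  by rewrite Rabs_Ropp; apply; lra.
have [h1 h2] := sub_sin_le_cube x0.
rewrite -Rabs_Ropp (Rabs_pos_eq x) // Rabs_pos_eq; last lra.
have x3 : 0 <= x ^ 3 by apply: pow_le.
split; last lra.
have [x1|x1] := Rle_dec x 1.
  have : x ^ 3 <= x ^ 2 by nra.
  by have := pow2_ge_0 x; lra.
have := SIN_bound x; nra.
Qed.

Lemma cos_taylor x : Rabs (cos x - 1 + x ^ 2 / 2) <= 2 * x ^ 2 /\
  Rabs (cos x - 1 + x ^ 2 / 2) <= Rabs x ^ 3.
Proof.
wlog x0 : x / 0 <= x => [h|].
  have [x0|x0] := Rle_dec 0 x; first exact: h.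
  have := h (- x); rewrite cos_neg Rabs_Ropp.
  have -> : (- x) ^ 2 = x ^ 2 by ring.
  by apply; lra.
have y0 : 0 <= x / 2 by lra.
have [h1 h2] := sub_sin_le_cube y0; have h3 := Rabs_sin_le (x / 2).
rewrite (Rabs_pos_eq (x / 2)) // in h3; have h4 := Rle_abs (- sin (x / 2)).
rewrite Rabs_Ropp in h4.
have e : cos x - 1 + x ^ 2 / 2 = 2 * (x / 2 - sin (x / 2)) * (x / 2 + sin (x / 2)).
  by have := one_sub_cos x; lra.
rewrite (Rabs_pos_eq x) // e; move: (sin (x / 2)) h1 h2 h3 h4 => s h1 h2 h3 h4 {e}.
rewrite Rabs_pos_eq; last by apply: Rmult_le_pos; lra.
have e1 : 2 * (x / 2 - s) * (x / 2 + s) <= x ^ 2 / 2 by nra.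
split; first by nra.
have [x1|x1] := Rle_dec x 1; last first.
  have : x ^ 2 <= x ^ 3 by nra.
  by have := pow2_ge_0 x; lra.
have e2 : 2 * (x / 2 - s) * (x / 2 + s) <= 2 * ((x / 2) ^ 3 / 6) * 1.
  by apply: Rmult_le_compat; lra.
have := pow_le _ 3 x0; lra.
Qed.

Lemma exp_neg_taylor y : 0 <= y -> Rabs (exp (- y) - (1 - y)) <= y ^ 2.
Proof.
move=> y0; have h1 := exp_ineq1_le (- y); have h2 := exp_ineq1_le y.
have h3 : exp (- y) <= / (1 + y).
  by rewrite exp_Ropp; apply: Rinv_le_contravar; lra.
have h4 : / (1 + y) <= 1 - y + y ^ 2.
  apply: (@Rmult_le_reg_l (1 + y)); first lra.
  by rewrite Rinv_r; [have := pow_le _ 3 y0|]; lra.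
by rewrite Rabs_pos_eq; lra.
Qed.

Lemma Rabs_sin_mulrn (k : nat) x : Rabs (sin (INR k * x)) <= INR k * Rabs (sin x).
Proof.
elim: k => [|k IH]; first by rewrite /= !Rmult_0_l sin_0 Rabs_R0; lra.
rewrite S_INR !Rmult_plus_distr_r !Rmult_1_l sin_plus.
apply: Rle_trans (Rabs_triang _ _) _; rewrite !Rabs_mult.
have c1 y : Rabs (cos y) <= 1 by apply: Rabs_le; exact: COS_bound.
have := Rabs_pos (sin (INR k * x)); have := Rabs_pos (sin x).
have := c1 x; have := c1 (INR k * x); nra.
Qed.

Lemma exp_mulrn x (n : nat) : exp x ^ n = exp (INR n * x).
Proof.
elim: n => [|n IH]; first by rewrite /= Rmult_0_l exp_0.
by rewrite -tech_pow_Rmult IH -exp_plus S_INR; congr exp; ring.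
Qed.

(** A crude form of exponential decay; with [x] replaced by [c * x ^ 2] the bound has an elementary
    primitive, which suffices for the tail integral. *)
Lemma pow_one_sub_le x (n : nat) : 0 < x <= 1 -> (0 < n)%N -> (1 - x) ^ n <= / (INR n * x).
Proof.
move=> [x0 x1] n0; have nR : 0 < INR n by apply: lt_0_INR; apply/ltP.
have h1 : (1 - x) ^ n <= exp (INR n * - x).
  by rewrite -exp_mulrn; apply: pow_incr; have := exp_ineq1_le (- x); lra.
apply: Rle_trans h1 _; have -> : INR n * - x = - (INR n * x) by ring.
rewrite exp_Ropp; apply: Rinv_le_contravar; first exact: Rmult_lt_0_compat.
by have := exp_ineq1_le (INR n * x); lra.
Qed.

End Calculus.

(** * The modulus of complex numbers and the unit circle *)

Section ComplexNorm.
Implicit Types (z : R[i]) (x y : R).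

Definition nm z : R := Normc.normc z.
Arguments nm : simpl never.
Definition expi x : R[i] := Complex (cos x) (sin x).

Lemma expiD x y : expi (x + y) = (expi x * expi y)%R.
Proof.
apply/eqP; rewrite eq_complex /= cos_plus sin_plus; apply/andP; split; apply/eqP => //.
by rewrite Rplus_comm; congr Rplus; exact: Rmult_comm.
Qed.

Lemma expi0 : expi 0 = 1%R.
Proof. by rewrite /expi cos_0 sin_0. Qed.

Lemma expiM (n : nat) x : (expi x ^+ n)%R = expi (INR n * x).
Proof.
elim: n => [|n IH]; first by rewrite /= Rmult_0_l expi0.
by rewrite GRing.exprS IH -expiD S_INR; congr expi; ring.
Qed.

Lemma nmM z1 z2 : nm (z1 * z2)%R = nm z1 * nm z2.
Proof. exact: Normc.normcM. Qed.

Lemma nmX z (n : nat) : nm (z ^+ n)%R = nm z ^ n.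
Proof.
elim: n => [|n IH]; first by rewrite GRing.expr0 /nm Normc.normc1.
by rewrite GRing.exprS nmM IH.
Qed.

Lemma nmD z1 z2 : nm (z1 + z2)%R <= nm z1 + nm z2.
Proof. by apply/RleP; exact: le_normcD. Qed.

Lemma nmE x y : nm (Complex x y) = sqrt (x ^ 2 + y ^ 2).
Proof. by rewrite /nm RsqrtE ?RpowE //; apply/RleP; nra. Qed.

Lemma nm_ge0 z : 0 <= nm z.
Proof. by case: z => x y; rewrite nmE; exact: sqrt_pos. Qed.

Lemma nm_sqr x y : nm (Complex x y) ^ 2 = x ^ 2 + y ^ 2.
Proof. by rewrite nmE pow2_sqrt //; nra. Qed.

Lemma Re_le_nm z : Rabs (complex.Re z) <= nm z.
Proof.
case: z => x y; rewrite nmE [complex.Re _]/=; apply: Rsqr_incr_0_var; last exact: sqrt_pos.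
by rewrite -Rsqr_abs Rsqr_sqrt /Rsqr; nra.
Qed.

Lemma nm_le_abs x y : nm (Complex x y) <= Rabs x + Rabs y.
Proof.
have h1 := Rabs_pos x; have h2 := Rabs_pos y.
rewrite nmE; apply: Rsqr_incr_0_var; last lra.
rewrite Rsqr_sqrt; last by nra.
by rewrite -(pow2_abs x) -(pow2_abs y) /Rsqr; nra.
Qed.

Lemma nm_expi x : nm (expi x) = 1.
Proof. by rewrite /expi nmE -[RHS]sqrt_1; congr sqrt; have := sin2_cos2 x; rewrite /Rsqr; lra. Qed.

Lemma nm_real x : nm (Complex x 0) = Rabs x.
Proof.
by rewrite (nmE x 0) -sqrt_Rsqr_abs; congr sqrt; rewrite /Rsqr; ring.
Qed.

Lemma nm_expi_sub1 x : nm (expi x - 1)%R <= Rabs x.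
Proof.
have -> : (expi x - 1)%R = Complex (cos x - 1) (sin x).
  by rewrite /expi; apply/eqP; rewrite eq_complex /=; apply/andP; split; apply/eqP => //; rewrite GRing.subr0.
rewrite nmE -sqrt_Rsqr_abs; apply: sqrt_le_1_alt; rewrite /Rsqr.
have := one_sub_cos x; have := sin2_cos2 x; have := sin_sqr_le (x / 2); rewrite /Rsqr; nra.
Qed.

Lemma nm_sub_exp z1 z2 (n : nat) : nm z1 <= 1 -> nm z2 <= 1 ->
  nm (z1 ^+ n - z2 ^+ n)%R <= INR n * nm (z1 - z2)%R.
Proof.
move=> h1 h2; elim: n => [|n IH].
  rewrite !GRing.expr0 GRing.subrr (_ : nm 0%R = 0); last exact: Normc.normc0.
  by rewrite Rmult_0_l; lra.
have -> : (z1 ^+ n.+1 - z2 ^+ n.+1 = z1 * (z1 ^+ n - z2 ^+ n) + (z1 - z2) * z2 ^+ n)%R.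
  by rewrite !GRing.exprS GRing.mulrBr GRing.mulrBl GRing.addrA GRing.subrK.
apply: Rle_trans (nmD _ _) _; rewrite !nmM S_INR nmX.
have p : nm z2 ^ n <= 1 by rewrite -(pow1 n); apply: pow_incr; split => //; exact: nm_ge0.
have := nm_ge0 z1; have := nm_ge0 (z1 ^+ n - z2 ^+ n)%R; have := nm_ge0 (z1 - z2)%R.
by move: (nm _) (nm (_ - _)%R) IH => *; nra.
Qed.

End ComplexNorm.

(** * Fourier inversion for a truncated lattice law *)

Section Fourier.
Variables (p : nat -> R) (B : nat).
Let Q : {poly R} := (\poly_(k < B.+1) p k)%R.

(* The characteristic function of [X - 1], where [X] has law [p] restricted to [[0, B]]. *)
Definition hfun (x : R) : R[i] :=
  (\sum_(k < B.+1) (p k)%:C%C * expi ((INR k - 1) * x))%R.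

Lemma hfun_horner x : hfun x = ((map_poly (real_complex R) Q).[expi x] * expi (- x))%R.
Proof.
have -> : map_poly (real_complex R) Q = (\poly_(k < B.+1) (p k)%:C%C)%R.
  apply/polyP => i; rewrite coef_map !coef_poly.
  by case: ifP => // _; exact: GRing.rmorph0.
rewrite horner_poly GRing.mulr_suml; apply: eq_bigr => k _.
by rewrite -GRing.mulrA expiM -expiD; congr (_ * expi _)%R; ring.
Qed.

Lemma Re_sum (I : Type) (r : seq I) (F : I -> R[i]) :
  complex.Re (\sum_(i <- r) F i)%R = \rsum_(i <- r) complex.Re (F i).
Proof. by apply: big_morph => // -[a b] [c d]. Qed.

Lemma Im_sum (I : Type) (r : seq I) (F : I -> R[i]) :
  complex.Im (\sum_(i <- r) F i)%R = \rsum_(i <- r) complex.Im (F i).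
Proof. by apply: big_morph => // -[a b] [c d]. Qed.

Lemma Re_scale (a : R) (z : R[i]) : complex.Re (a%:C%C * z)%R = a * complex.Re z.
Proof. by case: z => x y /=; rewrite GRing.mul0r GRing.subr0. Qed.

Lemma Im_scale (a : R) (z : R[i]) : complex.Im (a%:C%C * z)%R = a * complex.Im z.
Proof. by case: z => x y /=; rewrite GRing.mul0r GRing.addr0. Qed.

Lemma Re_hfun x : complex.Re (hfun x) = \rsum_(k < B.+1) (p k * cos ((INR k - 1) * x)).
Proof. by rewrite /hfun Re_sum; apply: eq_bigr => k _; rewrite Re_scale. Qed.

Lemma Im_hfun x : complex.Im (hfun x) = \rsum_(k < B.+1) (p k * sin ((INR k - 1) * x)).
Proof. by rewrite /hfun Im_sum; apply: eq_bigr => k _; rewrite Im_scale. Qed.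

Lemma fourier_expansion N L x :
  complex.Re (hfun x ^+ N * expi (L * x))%R =
  \rsum_(k < size (Q ^+ N)%R) ((Q ^+ N)%R`_k * cos ((INR k - (INR N - L)) * x)).
Proof.
rewrite hfun_horner GRing.exprMn expiM -GRing.mulrA -expiD -horner_exp -GRing.rmorphXn.
rewrite horner_coef size_map_poly GRing.mulr_suml Re_sum; apply: eq_bigr => k _.
rewrite coef_map -GRing.mulrA expiM -expiD Re_scale; congr (_ * cos _).
have key (a b c : R) : a * x + (b * - x + c * x) = (a - (b - c)) * x by ring.
exact: key.
Qed.

Lemma coef_exp_support d N k : (forall i, p i <> 0 -> (d %| i)%N) ->
  ~~ (d %| k)%N -> (Q ^+ N)%R`_k = 0.
Proof.
move=> hd; elim: N k => [|N IH] k dk.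
  by rewrite GRing.expr0 coef1; case: eqP => // k0; rewrite k0 dvdn0 in dk.
rewrite GRing.exprS coefM big1 // => i _.
have [di|di] := boolP (d %| i)%N.
  rewrite IH ?GRing.mulr0 // dvdn_subl //; first by rewrite -ltnS.
rewrite coef_poly; case: ifP => _; rewrite ?GRing.mul0r //.
have -> : p i = 0; last by rewrite GRing.mul0r.
have [//|h] := Req_dec (p i) 0.
by move: di; rewrite hd.
Qed.

Lemma is_RInt_rsum (I : Type) (r : seq I) (F : I -> R -> R) (v : I -> R) a b :
  (forall i, is_RInt (F i) a b (v i)) ->
  is_RInt (fun x => \rsum_(i <- r) F i x) a b (\rsum_(i <- r) v i).
Proof.
move=> h; elim: r => [|i r IH].
  rewrite big_nil; apply: (@is_RInt_ext _ (fun=> 0)) => [x _|]; first by rewrite big_nil.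
  have := @is_RInt_const R_NormedModule a b (0 : R).
  by rewrite /scal /= /mult /= Rmult_0_r.
rewrite big_cons; apply: (@is_RInt_ext _ (fun x => plus (F i x) (\rsum_(j <- r) F j x))).
  by move=> x _; rewrite big_cons.
exact: is_RInt_plus.
Qed.

(** Orthogonality on an interval shortened by the span: frequencies differ by a multiple of [d], so
    the primitive, a sine, vanishes at both 0 and [PI / d]. *)
Lemma is_RInt_cos_lattice (c : R) (d j a : nat) : (0 < d)%N -> (d %| j)%N -> (d %| a)%N ->
  is_RInt (fun x => c * cos ((INR j - INR a) * x)) 0 (PI / INR d)
    (if j == a then c * (PI / INR d) else 0).
Proof.
move=> d0 dj da; have dR : INR d <> 0 by apply: not_0_INR => e; rewrite e in d0.
case: eqP => [->|ne].
  have -> : c * (PI / INR d) = scal (PI / INR d - 0) c by rewrite /scal /= /mult /=; ring.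
  apply: (@is_RInt_ext _ (fun=> c)) => [x _|]; last exact: is_RInt_const.
  by rewrite Rminus_diag Rmult_0_l cos_0 Rmult_1_r.
have m0 : INR j - INR a <> 0 by move=> h; apply: ne; apply: INR_eq; lra.
pose f x := c * sin ((INR j - INR a) * x) / (INR j - INR a).
have e : minus (f (PI / INR d)) (f 0) = 0.
  have -> : f (PI / INR d) = 0; last first.
    by rewrite /f Rmult_0_r sin_0 Rmult_0_r /Rdiv Rmult_0_l minus_eq_zero.
  rewrite /f; have -> : sin ((INR j - INR a) * (PI / INR d)) = 0; last by field.
  case/dvdnP: dj => u ->; case/dvdnP: da => w ->.
  rewrite -multE !mult_INR.
  have -> : (INR u * INR d - INR w * INR d) * (PI / INR d) = IZR (Z.sub (Z.of_nat u) (Z.of_nat w)) * PI.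
    by rewrite minus_IZR -!INR_IZR_INZ; field.
  by apply: sin_eq_0_1; exists (Z.sub (Z.of_nat u) (Z.of_nat w)).
rewrite -[X in is_RInt _ _ _ X]e; apply: is_RInt_derive => [x _|x _].
  by rewrite /f; auto_derive => //; field.
by apply: (@ex_derive_continuous R_AbsRing R_NormedModule); auto_derive.
Qed.

Lemma is_RInt_fourier d N L : (0 < d)%N -> (forall i, p i <> 0 -> (d %| i)%N) ->
  (L <= N)%N -> (d %| N - L)%N ->
  is_RInt (fun x => complex.Re (hfun x ^+ N * expi (INR L * x))%R) 0 (PI / INR d)
    ((Q ^+ N)%R`_(N - L) * (PI / INR d)).
Proof.
move=> d0 hd LN dN.
apply: (@is_RInt_ext _ (fun x => \rsum_(k < size (Q ^+ N)%R)
    ((Q ^+ N)%R`_k * cos ((INR k - INR (N - L)) * x)))).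
  by move=> x _; rewrite fourier_expansion minus_INR //; apply/leP.
have -> : (Q ^+ N)%R`_(N - L) * (PI / INR d) = \rsum_(k < size (Q ^+ N)%R)
   (if nat_of_ord k == (N - L)%N then (Q ^+ N)%R`_k * (PI / INR d) else 0).
  have [h|h] := ltnP (N - L) (size (Q ^+ N)%R).
    rewrite -big_mkcond (big_pred1 (Ordinal h)) //.
  rewrite nth_default // Rmult_0_l big1 // => k _; case: eqP => // e.
  by have := ltn_ord k; rewrite e ltnNge h.
apply: is_RInt_rsum => k; have [dk|dk] := boolP (d %| k)%N; first exact: is_RInt_cos_lattice.
rewrite (coef_exp_support _ hd dk) Rmult_0_l if_same.
apply: (@is_RInt_ext _ (fun=> 0)) => [x _|]; first by rewrite Rmult_0_l.
have := @is_RInt_const R_NormedModule 0 (PI / INR d) (0 : R).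
by rewrite /scal /= /mult /= Rmult_0_r.
Qed.

End Fourier.

Lemma sum_f_R0E f n : sum_f_R0 f n = \rsum_(k < n.+1) f k.
Proof.
elim: n => [|n IH]; first by rewrite big_ord_recl big_ord0 /= Rplus_0_r.
by rewrite big_ord_recr /= IH.
Qed.

Lemma infinite_sum_psum f l eta : infinite_sum f l -> 0 < eta ->
  exists B0, forall B, (B0 <= B)%N -> Rabs ((\rsum_(k < B.+1) f k) - l) <= eta.
Proof.
move=> h e0; have [B0 hB] := h _ e0; exists B0 => B BB.
rewrite -sum_f_R0E; apply/Rlt_le; apply: hB; exact/leP.
Qed.

Lemma psum_le_sum f l B : (forall k, 0 <= f k) -> infinite_sum f l -> \rsum_(k < B) f k <= l.
Proof.
move=> f0 h; case: B => [|B].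
  rewrite big_ord0; apply: Rle_trans (sum_incr _ 0 _ h f0); exact: (f0 0%N).
by rewrite -sum_f_R0E; exact: sum_incr.
Qed.

Lemma nm_sum (I : Type) (r : seq I) (P : pred I) (F : I -> R[i]) :
  nm (\sum_(i <- r | P i) F i)%R <= \big[Rplus/0]_(i <- r | P i) nm (F i).
Proof.
apply: (big_ind2 (fun z y => nm z <= y)).
- by rewrite (_ : nm 0%R = 0); [lra|exact: Normc.normc0].
- by move=> z1 y1 z2 y2 h1 h2; apply: Rle_trans (nmD _ _) _; lra.
- by move=> i _; lra.
Qed.

(** * Bounds on the characteristic function and the local limit theorem *)

Section LocalLimit.
Variables (p : nat -> R) (d : nat) (V : R).
Hypothesis p_ge0 : forall k, 0 <= p k.
Hypothesis sum_p : infinite_sum p 1.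
Hypothesis sum_p1 : infinite_sum (fun k => INR k * p k) 1.
Hypothesis sum_p2 : infinite_sum (fun k => INR k ^ 2 * p k) V.
Hypothesis p_0 : 0 < p 0.
Hypothesis p_pos : exists k, (0 < k)%N /\ 0 < p k.
Hypothesis d_dvd : forall k, 0 < p k -> (d %| k)%N.
Hypothesis d_gcd : forall d', (forall k, 0 < p k -> (d' %| k)%N) -> (d' %| d)%N.

Local Notation h := (hfun p).

Lemma nm_scale_expi a x : 0 <= a -> nm (a%:C%C * expi x)%R = a.
Proof. by move=> a0; rewrite nmM nm_expi Rmult_1_r (nm_real a) Rabs_pos_eq. Qed.

(** The law of cosines gives the squared modulus [(a + b) ^ 2 - 4 * t], where [t] is [a * b] times
    the squared sine. As [a + b <= 1], this is at most [(a + b - 2 * t) ^ 2], which removes the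
    square root. *)
Lemma nm_two_atoms a b x y : 0 <= a -> 0 <= b -> a + b <= 1 ->
  nm (a%:C%C * expi x + b%:C%C * expi y)%R <= a + b - 2 * (a * b) * sin ((y - x) / 2) ^ 2.
Proof.
move=> a0 b0 ab.
have -> : (a%:C%C * expi x + b%:C%C * expi y)%R = Complex (a * cos x + b * cos y) (a * sin x + b * sin y).
  apply/eqP; rewrite eq_complex /= !GRing.mul0r !GRing.subr0 !GRing.addr0.
  by apply/andP; split; apply/eqP.
have e : nm (Complex (a * cos x + b * cos y) (a * sin x + b * sin y)) ^ 2 =
   (a + b) ^ 2 - 4 * (a * b) * sin ((y - x) / 2) ^ 2.
  rewrite nm_sqr.
  have c := one_sub_cos (y - x); rewrite cos_minus in c.
  have hx := sin2_cos2 x; have hy := sin2_cos2 y; rewrite /Rsqr in hx hy.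
  have -> : (a * cos x + b * cos y) ^ 2 + (a * sin x + b * sin y) ^ 2 =
     a ^ 2 * (sin x * sin x + cos x * cos x) + b ^ 2 * (sin y * sin y + cos y * cos y)
     + 2 * (a * b) * (cos y * cos x + sin y * sin x) by ring.
  rewrite hx hy; have -> : cos y * cos x + sin y * sin x = 1 - 2 * sin ((y - x) / 2) ^ 2 by lra.
  ring.
have n0 := nm_ge0 (Complex (a * cos x + b * cos y) (a * sin x + b * sin y)).
move: (nm _) e n0 => X e X0.
have : 0 <= sin ((y - x) / 2) ^ 2 <= 1.
  by split; [exact: pow2_ge_0|have := SIN_bound ((y - x) / 2); nra].
move: (sin _ ^ 2) e => q e [q0 q1].
have ab0 : 0 <= a * b by apply: Rmult_le_pos.
have abq : 0 <= a * b * q <= a * b by nra.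
have ab4 : 4 * (a * b) <= (a + b) ^ 2 by have := pow2_ge_0 (a - b); lra.
have ab1 : (a + b) ^ 2 <= a + b by nra.
have e' : X * X = (a + b) ^ 2 - 4 * (a * b * q) by lra.
have -> : 2 * (a * b) * q = 2 * (a * b * q) by ring.
move: (a * b * q) abq e' => t abq e'.
apply: Rsqr_incr_0_var; last by lra.
rewrite /Rsqr e'.
have f1 : (a + b) * t <= 1 * t by apply: Rmult_le_compat_r; lra.
have f2 := pow2_ge_0 t.
have -> : (a + b - 2 * t) * (a + b - 2 * t) = (a + b) ^ 2 - 4 * ((a + b) * t) + 4 * t ^ 2 by ring.
lra.
Qed.

Lemma nm_hfun_le1 B x : nm (h B x) <= 1.
Proof.
apply: Rle_trans (nm_sum _ _ _) _; apply: Rle_trans (psum_le_sum B.+1 p_ge0 sum_p).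
apply: Req_le; apply: eq_bigr => k _; exact: nm_scale_expi.
Qed.

(** Only the interference of the atoms at 0 and [k] is exploited; the other atoms are bounded by
    their mass. *)
Lemma nm_hfun_atom k B x : (0 < k)%N -> (k <= B)%N ->
  2 * (p 0 * p k) * sin (INR k * (x / 2)) ^ 2 <= 1 - nm (h B x).
Proof.
move=> k0 kB; have kB1 : (k < B.+1)%N by [].
have hs := psum_le_sum B.+1 p_ge0 sum_p.
rewrite (bigD1 ord0) //= (bigD1 (Ordinal kB1)) /= in hs; last by rewrite -lt0n.
rewrite /hfun (bigD1 ord0) //= (bigD1 (Ordinal kB1)) /=; last by rewrite -lt0n.
rewrite GRing.addrA; set rest := (\sum_(i < B.+1 | _) _)%R.
have hr : nm rest <= \big[Rplus/0]_(i < B.+1 | (i != ord0) && (i != Ordinal kB1)) p i.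
  apply: Rle_trans (nm_sum _ _ _) _; apply: Req_le; apply: eq_bigr => j _; exact: nm_scale_expi.
move: (\big[Rplus/0]_(i < B.+1 | _) p i) hs hr => r hs hr.
have r0 : 0 <= nm rest := nm_ge0 rest.
have := @nm_two_atoms (p 0) (p k) ((0 - 1) * x) ((INR k - 1) * x) (p_ge0 0) (p_ge0 k).
have -> : ((INR k - 1) * x - (0 - 1) * x) / 2 = INR k * (x / 2) by field.
have := nmD ((p 0)%:C%C * expi ((0 - 1) * x) + (p k)%:C%C * expi ((INR k - 1) * x))%R rest.
move=> h1 h2; have {}h2 := h2 ltac:(lra).
apply: (@Rle_trans _ (1 - (p 0 + p k - 2 * (p 0 * p k) * sin (INR k * (x / 2)) ^ 2 + r))).
  by rewrite /=; lra.
by apply: Rplus_le_compat_l; apply: Ropp_le_contravar; apply: Rle_trans h1 _; lra.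
Qed.

(** The defect [1 - nm (h B x)] dominates the squared sine at [g * x / 2], uniformly in [x] and in
    the truncation level. The property holds on the support and is stable under multiples and
    differences, so a Bezout argument carries it to the span. *)
Definition controlled (g : nat) := exists C B0, 0 <= C /\ forall B, (B0 <= B)%N -> forall x,
  sin (INR g * (x / 2)) ^ 2 <= C * (1 - nm (h B x)).

Lemma controlled_support k : 0 < p k -> controlled k.
Proof.
move=> pk; have [->|k0] := posnP k.
  exists 0, 0%N; split; first lra.
  by move=> B _ x; rewrite [INR 0]/= !Rmult_0_l sin_0; lra.
have pp : 0 < 2 * (p 0 * p k) by have := Rmult_lt_0_compat _ _ p_0 pk; lra.
exists (/ (2 * (p 0 * p k))), k; split; first by apply/Rlt_le/Rinv_0_lt_compat.
move=> B kB x; have := nm_hfun_atom x k0 kB.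
move: (2 * (p 0 * p k)) pp => c c0 hc; apply: (Rmult_le_reg_l _ _ _ c0).
by rewrite -[X in _ <= X]Rmult_assoc Rinv_r ?Rmult_1_l //; lra.
Qed.

Lemma controlled_mul k g : controlled g -> controlled (k * g).
Proof.
move=> [C [B0 [C0 hC]]]; exists (INR k ^ 2 * C), B0; split.
  by apply: Rmult_le_pos => //; exact: pow2_ge_0.
move=> B BB x; rewrite -multE mult_INR Rmult_assoc.
apply: (@Rle_trans _ (INR k ^ 2 * sin (INR g * (x / 2)) ^ 2)).
  rewrite -Rpow_mult_distr -(pow2_abs (sin (INR k * _))) -(pow2_abs (INR k * _)).
  apply: pow_incr; split; first exact: Rabs_pos.
  rewrite Rabs_mult (Rabs_pos_eq (INR k)); last exact: pos_INR.
  exact: Rabs_sin_mulrn.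
rewrite Rmult_assoc; apply: Rmult_le_compat_l; [exact: pow2_ge_0|exact: hC].
Qed.

Lemma controlled_sub g g' : controlled (g + g') -> controlled g -> controlled g'.
Proof.
move=> [C [B0 [C0 hC]]] [C' [B0' [C0' hC']]]; exists (2 * (C + C')), (maxn B0 B0').
split; first lra.
move=> B; rewrite geq_max => /andP [b1 b2] x; have := hC _ b1 x; have := hC' _ b2 x.
set y := x / 2; rewrite -plusE plus_INR.
have -> : sin (INR g' * y) = sin ((INR g + INR g') * y) * cos (INR g * y) -
    cos ((INR g + INR g') * y) * sin (INR g * y).
  by rewrite -sin_minus; congr sin; ring.
have := COS_bound (INR g * y); have := COS_bound ((INR g + INR g') * y).
move: (sin ((INR g + INR g') * y)) (sin (INR g * y)) (cos ((INR g + INR g') * y))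
  (cos (INR g * y)) (nm _) => a b c e X c1 e1 h1 h2.
have ee : (a * e - c * b) ^ 2 <= 2 * (a ^ 2 + b ^ 2).
  have f1 : (a * e - c * b) ^ 2 <= 2 * (a * e) ^ 2 + 2 * (c * b) ^ 2.
    by have := pow2_ge_0 (a * e + c * b); lra.
  have f2 : (a * e) ^ 2 <= a ^ 2 * 1.
    by rewrite Rpow_mult_distr; apply: Rmult_le_compat_l; [exact: pow2_ge_0|nra].
  have f3 : (c * b) ^ 2 <= 1 * b ^ 2.
    by rewrite Rpow_mult_distr; apply: Rmult_le_compat_r; [exact: pow2_ge_0|nra].
  lra.
lra.
Qed.

Lemma controlled_gcd g g' : (0 < g)%N -> controlled g -> controlled g' -> controlled (gcdn g g').
Proof.
move=> g0 cg cg'; case: (egcdnP g' g0) => km kn e _.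
apply: (@controlled_sub (kn * g')); last exact: controlled_mul.
by rewrite -e; exact: controlled_mul.
Qed.

Lemma d_gt0 : (0 < d)%N.
Proof.
have [k [k0 pk]] := p_pos; have := d_dvd pk.
by case: (posnP d) => // ->; rewrite dvd0n => /eqP e; rewrite e in k0.
Qed.

(* The controlled integers are closed under gcd, so the least positive one divides the
   whole support, hence d. *)
Lemma controlled_span : controlled d.
Proof.
have ex : exists g, `[< (0 < g)%N /\ controlled g >].
  by have [k [k0 pk]] := p_pos; exists k; apply/asboolP; split=> //; exact: controlled_support.
case: (ex_minnP ex) => g /asboolP [g0 cg] gmin.
suff : (g %| d)%N by case/dvdnP => k ->; exact: controlled_mul.
apply: d_gcd => k /controlled_support ck.
have gg : (0 < gcdn g k)%N by rewrite gcdn_gt0 g0.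
have := gmin (gcdn g k); rewrite asboolT; last by split => //; exact: controlled_gcd.
move=> /(_ erefl) le; have e : gcdn g k = g.
  by apply/eqP; rewrite eqn_leq le dvdn_leq // dvdn_gcdl.
by rewrite -e dvdn_gcdr.
Qed.

Lemma nm_hfun_decay : exists c B0, 0 < c /\ forall B, (B0 <= B)%N -> forall x,
  0 <= x <= PI / INR d -> nm (h B x) <= 1 - c * x ^ 2.
Proof.
have [C [B0 [C0 hC]]] := controlled_span.
have dR : 0 < INR d by apply: lt_0_INR; apply/ltP; exact: d_gt0.
(* On the interval [d * x / 2 <= PI / 2 <= 2], so its sine is at least [d * x / 6], whence 36;
   [C + 1] instead of [C] guards against [C = 0]. *)
exists (INR d ^ 2 / (36 * (C + 1))), B0; split.
  by apply: Rdiv_lt_0_compat; [apply: pow_lt|lra].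
move=> B BB x [x0 x1]; have := hC B BB x; have := nm_hfun_le1 B x.
have dx : 0 <= INR d * (x / 2) <= 2.
  split; first by apply: Rmult_le_pos; lra.
  have : INR d * x <= INR d * (PI / INR d) by apply: Rmult_le_compat_l; lra.
  have -> : INR d * (PI / INR d) = PI by field; lra.
  by have := PI_4; lra.
have := sin_ge_third dx; move: (sin _) => s hs n1 hn.
have hs2 : (INR d * (x / 2) / 3) ^ 2 <= s ^ 2 by apply: pow_incr; lra.
have e1 : (C + 1) * (INR d ^ 2 / (36 * (C + 1)) * x ^ 2) <= (C + 1) * (1 - nm (h B x)).
  have -> : (C + 1) * (INR d ^ 2 / (36 * (C + 1)) * x ^ 2) = (INR d * (x / 2) / 3) ^ 2.
    by field; lra.
  lra.
have := Rmult_le_reg_l _ _ _ _ e1; lra.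
Qed.

(** Split at [K], beyond which the second moment is at most [eps / 4]: values below [K] get the
    cubic bound, small with [K ^ 3 * x], and the others the quadratic one. The abstract [q] serves
    the remainders of both sine and cosine. *)
Lemma Taylor_error eps : 0 < eps -> exists x0 B0, 0 < x0 <= 1 /\
  forall B, (B0 <= B)%N -> forall x, 0 <= x <= x0 ->
  forall q : R -> R, (forall y, q y <= 2 * y ^ 2 /\ q y <= Rabs y ^ 3) ->
  \rsum_(k < B.+1) (p k * q ((INR k - 1) * x)) <= eps * x ^ 2.
Proof.
move=> eps0; have e4 : 0 < eps / 4 by lra.
have [K0 hK] := infinite_sum_psum sum_p2 e4.
have f0 k : 0 <= INR k ^ 2 * p k by apply: Rmult_le_pos => //; exact: pow2_ge_0.
set K := K0.+1; set m := INR K ^ 3.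
have K1 : 1 <= INR K by rewrite /K S_INR; have := pos_INR K0; lra.
have m1 : 1 <= m by exact: pow_R1_Rle.
exists (Rmin 1 (eps / (2 * m))), K; split.
  split; last exact: Rmin_l.
  by apply: Rmin_pos; [lra|apply: Rdiv_lt_0_compat; lra].
move=> B KB x [x0 xm] q hq.
have x1 : x <= 1 by apply: Rle_trans xm (Rmin_l _ _).
have mx : m * x <= eps / 2.
  have : m * x <= m * (eps / (2 * m)).
    by apply: Rmult_le_compat_l; [lra|apply: Rle_trans xm (Rmin_r _ _)].
  by have -> : m * (eps / (2 * m)) = eps / 2 by field; lra.
have x2 := pow2_ge_0 x.
pose big k := if (k < K)%N then 0 else INR k ^ 2 * p k.
have bigle : \rsum_(k < B.+1) big k <= eps / 4.
  have KB1 : (K <= B.+1)%N by apply: leq_trans KB _.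
  have := psum_le_sum B.+1 f0 sum_p2.
  have -> : \rsum_(k < B.+1) (INR k ^ 2 * p k) =
    (\rsum_(k < B.+1) (if (k < K)%N then INR k ^ 2 * p k else 0)) + \rsum_(k < B.+1) big k.
    by rewrite -big_split; apply: eq_bigr => k _; rewrite /big; case: ifP => _ /=; ring.
  rewrite -big_mkcond -(big_ord_widen _ (fun k => INR k ^ 2 * p k) KB1).
  have := proj1 (Rcomplements.Rabs_le_between _ _) (hK K0 (leqnn _)); rewrite -/K => hk1 hk2.
  move: hk1 hk2 => /=; lra.
apply: (@Rle_trans _ (\rsum_(k < B.+1) (p k * (m * x ^ 3) + big k * (2 * x ^ 2)))).
  apply: rsum_le => k; have [q1 q2] := hq ((INR k - 1) * x).
  rewrite /big; case: ltnP => kK.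
    rewrite Rmult_0_l Rplus_0_r; apply: Rmult_le_compat_l => //; apply: Rle_trans q2 _.
    rewrite Rabs_mult (Rabs_pos_eq x) // Rpow_mult_distr; apply: Rmult_le_compat_r.
      exact: pow_le.
    apply: pow_incr; split; first exact: Rabs_pos.
    have : INR k <= INR K by apply: le_INR; apply/leP; exact: ltnW.
    by have := pos_INR k => h1 h2; apply: Rabs_le; lra.
  have k1 : 1 <= INR k by apply: Rle_trans K1 _; apply: le_INR; exact/leP.
  have e1 : p k * q ((INR k - 1) * x) <= p k * (2 * ((INR k - 1) * x) ^ 2) by apply: Rmult_le_compat_l.
  have e2 : ((INR k - 1) * x) ^ 2 <= INR k ^ 2 * x ^ 2.
    by rewrite Rpow_mult_distr; apply: Rmult_le_compat_r => //; apply: pow_incr; lra.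
  have e3 : p k * ((INR k - 1) * x) ^ 2 <= p k * (INR k ^ 2 * x ^ 2) by apply: Rmult_le_compat_l.
  have e4' : 0 <= p k * (m * x ^ 3).
    by apply: Rmult_le_pos => //; apply: Rmult_le_pos; [lra|exact: pow_le].
  lra.
rewrite big_split -!big_distrl /=.
have s1 := psum_le_sum B.+1 p_ge0 sum_p.
have mx3 : m * x ^ 3 <= eps / 2 * x ^ 2.
  have -> : m * x ^ 3 = m * x * x ^ 2 by ring.
  exact: Rmult_le_compat_r.
have mx0 : 0 <= m * x ^ 3 by apply: Rmult_le_pos; [lra|exact: pow_le].
have t1 : (\rsum_(k < B.+1) p k) * (m * x ^ 3) <= 1 * (m * x ^ 3) by apply: Rmult_le_compat_r.
have t2 : (\rsum_(k < B.+1) big k) * (2 * x ^ 2) <= eps / 4 * (2 * x ^ 2) by apply: Rmult_le_compat_r; lra.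
by apply: Rle_trans (Rplus_le_compat _ _ _ _ t1 t2) _; lra.
Qed.

Lemma Rabs_rsum (I : Type) (r : seq I) (f : I -> R) :
  Rabs (\rsum_(i <- r) f i) <= \rsum_(i <- r) Rabs (f i).
Proof.
elim: r => [|i r IH]; rewrite ?big_nil ?big_cons; first by rewrite Rabs_R0; lra.
by apply: Rle_trans (Rabs_triang _ _) _; lra.
Qed.

(** [X - 1] has mean 0 and variance [V - 1]. The order of quantifiers matters: [x0] depends on [eps]
    alone, while the truncation error [eta] can later be taken of order [1 / N] by raising [B]. *)
Lemma hfun_Taylor eps : 0 < eps -> exists x0, 0 < x0 /\ forall eta, 0 < eta ->
  exists B0, forall B, (B0 <= B)%N -> forall x, 0 <= x <= x0 ->
  Rabs (complex.Re (h B x) - (1 - (V - 1) * x ^ 2 / 2)) <= eps * x ^ 2 + eta /\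
  Rabs (complex.Im (h B x)) <= eps * x ^ 2 + eta.
Proof.
move=> eps0; have [x0 [B1 [[x00 x01] hT]]] := Taylor_error eps0.
exists x0; split => // eta eta0; have e8 : 0 < eta / 8 by lra.
have [b0 h0] := infinite_sum_psum sum_p e8.
have [b1 h1] := infinite_sum_psum sum_p1 e8.
have [b2 h2] := infinite_sum_psum sum_p2 e8.
exists (maxn B1 (maxn b0 (maxn b1 b2))) => B; rewrite !geq_max => /and4P [c1 /h0 {}h0 /h1 {}h1 /h2 {}h2].
move=> x xx.
have [xa xb] := xx; rewrite Re_hfun Im_hfun.
have {}h0 := proj1 (Rcomplements.Rabs_le_between _ _) h0.
have {}h1 := proj1 (Rcomplements.Rabs_le_between _ _) h1.
have {}h2 := proj1 (Rcomplements.Rabs_le_between _ _) h2.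
move: h0 h1 h2.
set s0 := \rsum_(k < B.+1) p k; set s1 := \rsum_(k < B.+1) (INR k * p k).
set s2 := \rsum_(k < B.+1) (INR k ^ 2 * p k) => h0 h1 h2.
have x2 : 0 <= x ^ 2 <= 1 by nra.
split.
  have -> : (\rsum_(k < B.+1) (p k * cos ((INR k - 1) * x))) - (1 - (V - 1) * x ^ 2 / 2) =
     (\rsum_(k < B.+1) (p k * (cos ((INR k - 1) * x) - 1 + ((INR k - 1) * x) ^ 2 / 2)))
     + ((s0 - 1) - x ^ 2 / 2 * ((s2 - V) - 2 * (s1 - 1) + (s0 - 1))).
    have -> : \rsum_(k < B.+1) (p k * (cos ((INR k - 1) * x) - 1 + ((INR k - 1) * x) ^ 2 / 2)) =
      (\rsum_(k < B.+1) (p k * cos ((INR k - 1) * x))) + (s0 * (x ^ 2 / 2 - 1) +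
       (s1 * (- x ^ 2) + s2 * (x ^ 2 / 2))).
      rewrite /s0 /s1 /s2 !big_distrl -!big_split; apply: eq_bigr => k _ /=; field.
    field.
  apply: Rle_trans (Rabs_triang _ _) _; apply: Rplus_le_compat.
    apply: Rle_trans (Rabs_rsum _ _) _.
    apply: Rle_trans (hT B c1 x xx (fun y => Rabs (cos y - 1 + y ^ 2 / 2)) cos_taylor).
    by apply: rsum_le => k; rewrite Rabs_mult (Rabs_pos_eq (p k)) //; lra.
  by apply: Rabs_le; nra.
have -> : \rsum_(k < B.+1) (p k * sin ((INR k - 1) * x)) =
   (\rsum_(k < B.+1) (p k * (sin ((INR k - 1) * x) - (INR k - 1) * x))) + x * ((s1 - 1) - (s0 - 1)).
  have -> : x * ((s1 - 1) - (s0 - 1)) = s1 * x + s0 * (- x) by ring.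
  rewrite /s0 /s1 !big_distrl -!big_split; apply: eq_bigr => k _ /=; ring.
apply: Rle_trans (Rabs_triang _ _) _; apply: Rplus_le_compat.
  apply: Rle_trans (Rabs_rsum _ _) _.
  apply: Rle_trans (hT B c1 x xx (fun y => Rabs (sin y - y)) sin_taylor).
  by apply: rsum_le => k; rewrite Rabs_mult (Rabs_pos_eq (p k)) //; lra.
by apply: Rabs_le; nra.
Qed.

Lemma V_ge1 : 1 <= V.
Proof.
apply: le_epsilon => e e0; have [B0 hB] := infinite_sum_psum sum_p1 e0.
have := proj1 (Rcomplements.Rabs_le_between _ _) (hB B0 (leqnn _)).
have : \rsum_(k < B0.+1) (INR k * p k) <= \rsum_(k < B0.+1) (INR k ^ 2 * p k).
  apply: rsum_le => k; apply: Rmult_le_compat_r => //.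
  case: (nat_of_ord k) => [|j]; first by rewrite /=; lra.
  by rewrite S_INR; have := pos_INR j; nra.
have : \rsum_(k < B0.+1) (INR k ^ 2 * p k) <= V.
  by apply: (psum_le_sum _ _ sum_p2) => k; apply: Rmult_le_pos => //; exact: pow2_ge_0.
move: (\rsum_(k < B0.+1) (INR k ^ 2 * p k)) (\rsum_(k < B0.+1) (INR k * p k)) => s2 s1; lra.
Qed.

(** Powers are Lipschitz with constant [N] on the unit disc, and replacing the phase by 1 costs
    [L * x]. For [x] of order [1 / sqrt N] the latter is small when [L] is small against [sqrt N]:
    hence the uniformity in [L]. *)
Lemma Re_pow_approx (z : R[i]) r e1 (N L : nat) x : 0 <= x -> nm z <= 1 -> 0 <= r <= 1 ->
  Rabs (complex.Re z - r) <= e1 -> Rabs (complex.Im z) <= e1 ->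
  Rabs (complex.Re (z ^+ N * expi (INR L * x))%R - r ^ N) <= INR N * (2 * e1) + INR L * x.
Proof.
move=> x0 z1 [r0 r1] hr hi; pose rc : R[i] := Complex r 0.
have rcX : complex.Re (rc ^+ N)%R = r ^ N.
  have -> : (rc ^+ N)%R = (real_complex R (r ^+ N)%R) by rewrite GRing.rmorphXn.
  by rewrite RpowE.
have -> : complex.Re (z ^+ N * expi (INR L * x))%R - r ^ N =
  complex.Re (z ^+ N * expi (INR L * x) - rc ^+ N)%R.
  by rewrite -rcX; case: (z ^+ N * _)%R (rc ^+ N)%R => a b [a' b'].
apply: Rle_trans (Re_le_nm _) _.
have -> : (z ^+ N * expi (INR L * x) - rc ^+ N =
   (z ^+ N - rc ^+ N) + z ^+ N * (expi (INR L * x) - 1))%R.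
  by rewrite GRing.mulrBr GRing.mulr1 [RHS]GRing.addrC GRing.addrA GRing.subrK.
apply: Rle_trans (nmD _ _) _; apply: Rplus_le_compat.
  apply: Rle_trans (nm_sub_exp N z1 _) _; first by rewrite nm_real Rabs_pos_eq.
  apply: Rmult_le_compat_l; first exact: pos_INR.
  case: z hr hi {z1 rcX} => a b hr hi.
  have -> : (Complex a b - rc)%R = Complex (a - r) b.
    by apply/eqP; rewrite eq_complex /= GRing.subr0 !eqxx.
  by apply: Rle_trans (nm_le_abs _ _) _; move: hr hi => /=; lra.
rewrite nmM nmX; have zN : nm z ^ N <= 1.
  by rewrite -(pow1 N); apply: pow_incr; split => //; exact: nm_ge0.
have := nm_expi_sub1 (INR L * x); rewrite Rabs_pos_eq; last by apply: Rmult_le_pos => //; exact: pos_INR.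
have := nm_ge0 (expi (INR L * x) - 1)%R; have := pow_le _ N (nm_ge0 z); nra.
Qed.

(** Allows the truncation level to be raised once [N] and the precision are known. *)
Lemma coef_exp_stable B B' N a : (a <= B)%N -> (a <= B')%N ->
  ((\poly_(k < B.+1) p k) ^+ N)%R`_a = ((\poly_(k < B'.+1) p k) ^+ N)%R`_a.
Proof.
elim: N a => [|N IH] a aB aB'; first by rewrite !GRing.expr0.
rewrite !coef_phi_expS //; apply: eq_bigr => j _; congr (_ * _)%R.
by apply: IH; apply: leq_trans (leq_subr _ _) _.
Qed.

Definition gauss u := exp (- ((V - 1) * u ^ 2 / 2)).

Lemma ex_RInt_gauss a b : ex_RInt gauss a b.
Proof.
apply: (@ex_RInt_continuous R_CompleteNormedModule) => x _.
by apply: (@ex_derive_continuous R_AbsRing R_NormedModule); rewrite /gauss; auto_derive.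
Qed.

(** The part over [[0, 1]] already gives a bound independent of [A], hence of the precision that
    determines [A]. *)
Lemma gauss_mass_ge A : 1 <= A -> exp (- ((V - 1) / 2)) <= RInt gauss 0 A.
Proof.
move=> A1; have V1 := V_ge1.
have e : RInt (fun=> exp (- ((V - 1) / 2))) 0 1 = exp (- ((V - 1) / 2)).
  by rewrite RInt_const /scal /= /mult /=; ring.
rewrite -[X in X <= _]e.
apply: (@Rle_trans _ (RInt gauss 0 1)).
  apply: RInt_le; [lra|exact: ex_RInt_const|exact: ex_RInt_gauss|].
  move=> x [x0 x1]; rewrite /gauss.
  have x2 : x ^ 2 <= 1 by nra.
  have : (V - 1) * x ^ 2 <= (V - 1) * 1 by apply: Rmult_le_compat_l; lra.
  move=> Vx; have [h|h] : - ((V - 1) / 2) <= - ((V - 1) * x ^ 2 / 2) by lra.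
    by apply: Rlt_le; exact: exp_increasing.
  by rewrite h; lra.
rewrite -(RInt_Chasles gauss 0 1 A) /plus /=; try exact: ex_RInt_gauss.
have : 0 <= RInt gauss 1 A.
  by apply: RInt_ge_0 => // [|x _]; [exact: ex_RInt_gauss|apply/Rlt_le/exp_pos].
move: (RInt _ _ _) (RInt _ _ _) => u v; lra.
Qed.

Lemma is_RInt_gauss_scaled (N : nat) A : (0 < N)%N ->
  is_RInt (fun x => gauss x ^ N) 0 (A / sqrt (INR N)) (RInt gauss 0 A / sqrt (INR N)).
Proof.
move=> N0; have NR : 0 < INR N by apply: lt_0_INR; apply/ltP.
have sN := sqrt_lt_R0 _ NR.
have := @is_RInt_comp_lin R_NormedModule gauss (sqrt (INR N)) 0 0 (A / sqrt (INR N)) (RInt gauss 0 A).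
have -> : sqrt (INR N) * 0 + 0 = 0 by ring.
have -> : sqrt (INR N) * (A / sqrt (INR N)) + 0 = A by field; lra.
have hc : is_RInt gauss 0 A (RInt gauss 0 A).
  by apply: (@RInt_correct R_CompleteNormedModule); exact: ex_RInt_gauss.
move/(_ hc) => h1.
have := @is_RInt_scal R_NormedModule _ _ _ (/ sqrt (INR N)) _ h1.
have -> : scal (/ sqrt (INR N)) (RInt gauss 0 A) = RInt gauss 0 A / sqrt (INR N).
  by rewrite /scal /= /mult /= /Rdiv Rmult_comm.
apply: is_RInt_ext => x _; rewrite /scal /= /mult /= /gauss exp_mulrn.
rewrite -Rmult_assoc Rinv_l ?Rmult_1_l; last lra.
congr exp; have -> : INR N = sqrt (INR N) ^ 2 by rewrite pow2_sqrt; lra.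
rewrite sqrt_pow2; last lra.
by rewrite /=; field.
Qed.

(** [K] is a Gaussian integral over [[0, A]] with [A] depending on [eps]; the lower bound on [K] is
    free of [eps], so a later choice of [eps] proportional to it yields a relative error. *)
Theorem local_limit eps : 0 < eps -> exists K delta n0,
  INR d / PI * exp (- ((V - 1) / 2)) <= K /\ 0 < delta /\
  forall N, (n0 <= N)%N -> forall L, (L <= N)%N -> INR L <= delta * sqrt (INR N) ->
  (d %| N - L)%N -> forall B, (N - L <= B)%N ->
  Rabs (sqrt (INR N) * ((\poly_(k < B.+1) p k) ^+ N)%R`_(N - L) - K) <= eps.
Proof.
move=> eps0; have V1 := V_ge1; have pi0 := PI_RGT_0.
have dR : 0 < INR d by apply: lt_0_INR; apply/ltP; exact: d_gt0.
have [c [B1 [c0 hdec]]] := nm_hfun_decay.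
have w0 : 0 < PI / INR d by exact: Rdiv_lt_0_compat.
set w := PI / INR d in w0 hdec.
set ed := eps * w; have ed0 : 0 < ed by exact: Rmult_lt_0_compat.
(* Times [sqrt N], the integral beyond [A / sqrt N] is at most [1 / (c * A)], hence at most
   [ed / 2]. *)
set A := 1 + 2 / (c * ed).
have ced : 0 < c * ed by exact: Rmult_lt_0_compat.
have q0 : 0 < 2 / (c * ed) by apply: Rdiv_lt_0_compat; lra.
have A1 : 1 <= A by rewrite /A; lra.
have Atail : / (c * A) <= ed / 2.
  have -> : ed / 2 = / (c * (2 / (c * ed))) by field; lra.
  apply: Rinv_le_contravar.
    by apply: Rmult_lt_0_compat => //; apply: Rdiv_lt_0_compat; lra.
  by apply: Rmult_le_compat_l; rewrite /A; lra.
have A3 : 0 < A ^ 3 by apply: pow_lt; lra.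
have eT : 0 < ed / (16 * A ^ 3) by apply: Rdiv_lt_0_compat; lra.
have [x0 [x00 hT]] := hfun_Taylor eT.
set X := Rmin x0 w; have X0 : 0 < X by apply: Rmin_pos.
(* The first bound puts [A / sqrt N] inside the range of the expansions; the second makes the
   quadratic error of the exponential, multiplied by [N], at most [ed / (16 * A)]. *)
have [n1 hn1] := INR_unbounded (Rmax (A ^ 2 / X ^ 2) (4 * (V - 1) ^ 2 * A ^ 5 / ed)).
exists (INR d / PI * RInt gauss 0 A), (ed / (8 * A ^ 2)), n1.+1.
have dpi : 0 < INR d / PI by exact: Rdiv_lt_0_compat.
split; first by apply: Rmult_le_compat_l; [lra|exact: gauss_mass_ge].
have A2 : 0 < A ^ 2 by apply: pow_lt; lra.
split; first by apply: Rdiv_lt_0_compat; lra.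
move=> N nN L LN Lsmall dN B aB.
have N0 : (0 < N)%N by apply: leq_trans nN.
have NR : 0 < INR N by apply: lt_0_INR; apply/ltP.
have N1 : INR n1 <= INR N by apply: le_INR; apply/leP; exact: ltnW.
have NX : A ^ 2 / X ^ 2 <= INR N by have := Rmax_l (A ^ 2 / X ^ 2) (4 * (V - 1) ^ 2 * A ^ 5 / ed); lra.
have NV : 4 * (V - 1) ^ 2 * A ^ 5 / ed <= INR N.
  by have := Rmax_r (A ^ 2 / X ^ 2) (4 * (V - 1) ^ 2 * A ^ 5 / ed); lra.
have sN := sqrt_lt_R0 _ NR; have sN2 : sqrt (INR N) ^ 2 = INR N by rewrite pow2_sqrt; lra.
set b := A / sqrt (INR N).
have b0 : 0 < b by apply: Rdiv_lt_0_compat; lra.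
have bX : b <= X.
  have : A / X <= sqrt (INR N).
    apply: Rsqr_incr_0_var; last lra.
    rewrite Rsqr_sqrt; last lra.
    by have -> : Rsqr (A / X) = A ^ 2 / X ^ 2 by rewrite /Rsqr; field; lra.
  move=> hb; apply: (@Rmult_le_reg_l (sqrt (INR N) / X)); first exact: Rdiv_lt_0_compat.
  have -> : sqrt (INR N) / X * b = A / X by rewrite /b; field; lra.
  by have -> : sqrt (INR N) / X * X = sqrt (INR N) by field; lra.
have bx0 : b <= x0 by apply: Rle_trans bX (Rmin_l _ _).
have bw : b <= w by apply: Rle_trans bX (Rmin_r _ _).
have b2 : INR N * b ^ 2 = A ^ 2 by rewrite /b -{1}sN2; field; lra.
have eta0 : 0 < ed / (16 * A * INR N).
  by apply: Rdiv_lt_0_compat => //; apply: Rmult_lt_0_compat => //; lra.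
have [B2 hB2] := hT _ eta0.
(* From here the level is [M], high enough for both characteristic function estimates and for the
   coefficient at hand. *)
set M := maxn (maxn B1 B2) N.
have hM1 : (B1 <= M)%N by rewrite /M !leq_max leqnn.
have hM2 : (B2 <= M)%N by rewrite /M !leq_max leqnn orbT.
have hMN : (N - L <= M)%N by apply: leq_trans (leq_subr _ _) _; rewrite /M leq_max leqnn orbT.
rewrite (coef_exp_stable N aB hMN).
set a := ((\poly_(k < M.+1) p k) ^+ N)%R`_(N - L).
pose g x := complex.Re (h M x ^+ N * expi (INR L * x))%R.
have p_supp i : p i <> 0 -> (d %| i)%N by move=> pi; apply: d_dvd; have := p_ge0 i; lra.
have hg : is_RInt g 0 w (a * w) := @is_RInt_fourier p M d N L d_gt0 p_supp LN dN.
have eg : ex_RInt g 0 w by exists (a * w).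
have eg1 : ex_RInt g 0 b by apply: (ex_RInt_Chasles_1 g 0 b w) => //; lra.
have eg2 : ex_RInt g b w by apply: (ex_RInt_Chasles_2 g 0 b w) => //; lra.
have split_g : a * w = RInt g 0 b + RInt g b w.
  have e1 : RInt g 0 w = a * w by exact: is_RInt_unique.
  have e2 := RInt_Chasles g 0 b w eg1 eg2.
  by rewrite -e1 -e2.
have hE := @is_RInt_gauss_scaled N A N0; rewrite -/b in hE.
(* Four errors are bounded in units of [ed / (16 * A)]: Taylor, truncation and exponential count 2
   each, the phase 2, in total 8. *)
have central : Rabs (RInt g 0 b - RInt gauss 0 A / sqrt (INR N)) <= b * (ed / (2 * A)).
  have -> : RInt g 0 b - RInt gauss 0 A / sqrt (INR N) = RInt (fun x => minus (g x) (gauss x ^ N)) 0 b.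
    apply/esym; apply: is_RInt_unique; apply: is_RInt_minus => //.
    exact: (@RInt_correct R_CompleteNormedModule).
  have -> : b * (ed / (2 * A)) = (b - 0) * (ed / (2 * A)) by ring.
  apply: abs_RInt_le_const; first lra.
    by apply: ex_RInt_minus => //; eexists; exact: hE.
  move=> x [xa xb].
  have x2b : x ^ 2 <= b ^ 2 by apply: pow_incr.
  have x2 := pow2_ge_0 x.
  have Nx2 : INR N * x ^ 2 <= A ^ 2 by rewrite -b2; apply: Rmult_le_compat_l; lra.
  have y0 : 0 <= (V - 1) * x ^ 2 / 2 by apply: Rmult_le_pos; [apply: Rmult_le_pos|]; lra.
  have := exp_neg_taylor y0; rewrite -/(gauss x) => hgx.
  have g01 : 0 <= gauss x <= 1.
    split; first by apply/Rlt_le/exp_pos.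
    rewrite -exp_0 /gauss; case: y0 => [y0|<-]; last by rewrite Ropp_0; lra.
    by apply/Rlt_le/exp_increasing; lra.
  have [t1 t2] := hB2 M hM2 x (conj xa (Rle_trans _ _ _ xb bx0)).
  set e1 := ed / (16 * A ^ 3) * x ^ 2 + ed / (16 * A * INR N) + ((V - 1) * x ^ 2 / 2) ^ 2.
  have q0' := pow2_ge_0 ((V - 1) * x ^ 2 / 2).
  have u1 : Rabs (complex.Re (h M x) - gauss x) <= e1.
    have -> : complex.Re (h M x) - gauss x = (complex.Re (h M x) - (1 - (V - 1) * x ^ 2 / 2)) +
      - (gauss x - (1 - (V - 1) * x ^ 2 / 2)) by ring.
    by apply: Rle_trans (Rabs_triang _ _) _; rewrite Rabs_Ropp; apply: Rplus_le_compat.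
  have u2 : Rabs (complex.Im (h M x)) <= e1 by rewrite /e1; lra.
  have := Re_pow_approx N L xa (nm_hfun_le1 M x) g01 u1 u2.
  rewrite -/(g x) => hfin; apply: Rle_trans hfin _.
  have v1 : INR N * (ed / (16 * A ^ 3) * x ^ 2) <= ed / (16 * A).
    have -> : INR N * (ed / (16 * A ^ 3) * x ^ 2) = ed / (16 * A ^ 3) * (INR N * x ^ 2) by ring.
    have -> : ed / (16 * A) = ed / (16 * A ^ 3) * A ^ 2 by field; lra.
    by apply: Rmult_le_compat_l; lra.
  have v2 : INR N * (ed / (16 * A * INR N)) = ed / (16 * A) by field; lra.
  have v3 : INR N * ((V - 1) * x ^ 2 / 2) ^ 2 <= ed / (16 * A).
    have Nx4 : (INR N * x ^ 2) ^ 2 <= (A ^ 2) ^ 2.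
      by apply: pow_incr; split => //; apply: Rmult_le_pos; lra.
    have k1 : INR N * (INR N * ((V - 1) * x ^ 2 / 2) ^ 2) <= INR N * (ed / (16 * A)).
      have -> : INR N * (INR N * ((V - 1) * x ^ 2 / 2) ^ 2) = (V - 1) ^ 2 / 4 * (INR N * x ^ 2) ^ 2 by field.
      have VV := pow2_ge_0 (V - 1).
      apply: (@Rle_trans _ ((V - 1) ^ 2 / 4 * (A ^ 2) ^ 2)).
        by apply: Rmult_le_compat_l => //; lra.
      have -> : (V - 1) ^ 2 / 4 * (A ^ 2) ^ 2 = 4 * (V - 1) ^ 2 * A ^ 5 / ed * (ed / (16 * A)).
        by field; lra.
      apply: Rmult_le_compat_r => //.
      by apply/Rlt_le/Rdiv_lt_0_compat; lra.
    exact: Rmult_le_reg_l k1.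
  have v4 : INR L * x <= ed / (8 * A).
    have -> : ed / (8 * A) = ed / (8 * A ^ 2) * sqrt (INR N) * b by rewrite /b; field; lra.
    by apply: Rmult_le_compat => //; exact: pos_INR.
  have -> : INR N * (2 * e1) = 2 * (INR N * (ed / (16 * A ^ 3) * x ^ 2)) +
     2 * (INR N * (ed / (16 * A * INR N))) + 2 * (INR N * ((V - 1) * x ^ 2 / 2) ^ 2).
    by rewrite /e1; ring.
  rewrite v2; have -> : ed / (2 * A) = 8 * (ed / (16 * A)) by field; lra.
  rewrite (_ : ed / (8 * A) = 2 * (ed / (16 * A))) in v4; last by field; lra.
  lra.
have tail : Rabs (RInt g b w) <= / (INR N * c * b).
  pose F x := - / (INR N * c * x).
  have Nc : 0 < INR N * c by exact: Rmult_lt_0_compat.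
  have hF : is_RInt (fun x => / (INR N * (c * x ^ 2))) b w (minus (F w) (F b)).
    apply: is_RInt_derive => x; rewrite Rmin_left // Rmax_right // => -[xa xb].
      rewrite /F; auto_derive; first by apply: Rmult_integral_contrapositive; split; lra.
      by field; split; lra.
    apply: (@ex_derive_continuous R_AbsRing R_NormedModule); auto_derive.
    have xx : 0 < x ^ 2 by apply: pow_lt; lra.
    by apply: Rgt_not_eq; apply: Rmult_lt_0_compat => //; apply: Rmult_lt_0_compat => //; move: xx => /=; lra.
  have := @norm_RInt_le R_NormedModule g (fun x => / (INR N * (c * x ^ 2))) b w (RInt g b w) _ bw _ _ hF.
  move=> H; apply: Rle_trans (H _ _) _.
  - move=> x [xa xb]; rewrite /norm /= /abs /=; apply: Rle_trans (Re_le_nm _) _.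
    have xx : 0 < x ^ 2 by apply: pow_lt; lra.
    have nx := hdec M hM1 x (conj (Rle_trans _ _ _ (Rlt_le _ _ b0) xa) xb).
    have n0 := nm_ge0 (h M x).
    rewrite nmM nm_expi Rmult_1_r nmX; apply: (@Rle_trans _ ((1 - c * x ^ 2) ^ N)).
      by apply: pow_incr.
    have cx : 0 < c * x ^ 2 by exact: Rmult_lt_0_compat.
    by apply: pow_one_sub_le => //; lra.
  - exact: (@RInt_correct R_CompleteNormedModule).
  have : 0 < / (INR N * c * w) by apply: Rinv_0_lt_compat; exact: Rmult_lt_0_compat.
  by rewrite /F /minus /plus /Hierarchy.opp /=; lra.
have stail : sqrt (INR N) * / (INR N * c * b) <= ed / 2.
  by have -> : sqrt (INR N) * / (INR N * c * b) = / (c * A) by rewrite /b -{2}sN2; field; lra.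
have fin : Rabs (sqrt (INR N) * (a * w) - RInt gauss 0 A) <= ed.
  have -> : sqrt (INR N) * (a * w) - RInt gauss 0 A =
    sqrt (INR N) * (RInt g 0 b - RInt gauss 0 A / sqrt (INR N)) + sqrt (INR N) * RInt g b w.
    by rewrite split_g; field; lra.
  apply: Rle_trans (Rabs_triang _ _) _; rewrite !Rabs_mult (Rabs_pos_eq (sqrt _)); last lra.
  have k1 : sqrt (INR N) * Rabs (RInt g 0 b - RInt gauss 0 A / sqrt (INR N)) <=
     sqrt (INR N) * (b * (ed / (2 * A))) by apply: Rmult_le_compat_l; lra.
  have k2 : sqrt (INR N) * (b * (ed / (2 * A))) = ed / 2 by rewrite /b; field; lra.
  have k3 : sqrt (INR N) * Rabs (RInt g b w) <= sqrt (INR N) * / (INR N * c * b).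
    by apply: Rmult_le_compat_l; lra.
  lra.
have -> : sqrt (INR N) * a - INR d / PI * RInt gauss 0 A =
   (sqrt (INR N) * (a * w) - RInt gauss 0 A) * / w by rewrite /w; field; lra.
rewrite Rabs_mult (Rabs_pos_eq (/ w)); last by apply/Rlt_le/Rinv_0_lt_compat.
have -> : eps = ed * / w by rewrite /ed; field; lra.
by apply: Rmult_le_compat_r => //; apply/Rlt_le/Rinv_0_lt_compat.
Qed.

End LocalLimit.

(** * Comparison of the two laws *)

Lemma rsum_iota f n : \rsum_(k <- iota 0 n) f k = \rsum_(k < n) f k.
Proof. by rewrite -(val_enum_ord n) big_map big_enum. Qed.

Lemma infinite_sum_scal f l c : infinite_sum f l -> infinite_sum (fun k => f k * c) (l * c).
Proof.
move=> h e e0; have c1 : 0 < Rabs c + 1 by have := Rabs_pos c; lra.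
have [N hN] := h (e / (Rabs c + 1)) ltac:(exact: Rdiv_lt_0_compat).
exists N => n nN; rewrite -scal_sum /R_dist; have := hN n nN; rewrite /R_dist => {}hN.
have -> : c * sum_f_R0 f n - l * c = (sum_f_R0 f n - l) * c by ring.
rewrite Rabs_mult; apply: (@Rle_lt_trans _ (Rabs (sum_f_R0 f n - l) * (Rabs c + 1))).
  by apply: Rmult_le_compat_l; [exact: Rabs_pos|lra].
have -> : e = e / (Rabs c + 1) * (Rabs c + 1) by field; lra.
exact: Rmult_lt_compat_r.
Qed.

Lemma infinite_sum_ext f g l : (forall k, f k = g k) -> infinite_sum f l -> infinite_sum g l.
Proof. by move=> fg; have -> : f = g by apply/funext. Qed.

Lemma NoDup_uniq (T : eqType) (l : seq T) : List.NoDup l -> uniq l.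
Proof.
elim=> //= x s xs _ ->; rewrite andbT; apply/negP => h; apply: xs.
elim: s h => //= y s IH; rewrite inE => /orP [/eqP ->|/IH]; [by left|by right].
Qed.

(** * The tilted law [pi], the quotient of the laws and total variation *)

Section Assembly.
Variables (S : wspecies) (span : nat) (tau Phi V : R).
Hypothesis omega0 : 0 < omega S 0.
Hypothesis omega2 : exists k, (2 <= k)%N /\ 0 < omega S k.
Hypothesis span_ok : is_span S span.
Hypothesis tau0 : 0 < tau.
Hypothesis phi0 : infinite_sum (fun k => omega S k * tau ^ k) Phi.
Hypothesis phi1 : infinite_sum (fun k => INR k * (omega S k * tau ^ k)) Phi.
Hypothesis phi2 : infinite_sum (fun k => INR k ^ 2 * (omega S k * tau ^ k)) V.

Local Notation pi := (pi_tau S tau Phi).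
Local Notation ttree := (ttree S).

Lemma Phi_gt0 : 0 < Phi.
Proof.
have f0 k : 0 <= omega S k * tau ^ k.
  by apply: Rmult_le_pos; [exact: omega_ge0|apply: pow_le; lra].
have := psum_le_sum 1 f0 phi0; rewrite big_ord_recl big_ord0 /=; lra.
Qed.

Lemma pi_sum0 : infinite_sum pi 1.
Proof.
have P0 := Phi_gt0; have := infinite_sum_scal (/ Phi) phi0; rewrite Rinv_r; last lra.
by apply: infinite_sum_ext => k; rewrite /pi_tau /Rdiv; ring.
Qed.

Lemma pi_sum1 : infinite_sum (fun k => INR k * pi k) 1.
Proof.
have P0 := Phi_gt0; have := infinite_sum_scal (/ Phi) phi1; rewrite Rinv_r; last lra.
by apply: infinite_sum_ext => k; rewrite /pi_tau /Rdiv; ring.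
Qed.

Lemma pi_sum2 : infinite_sum (fun k => INR k ^ 2 * pi k) (V / Phi).
Proof.
have := infinite_sum_scal (/ Phi) phi2.
by apply: infinite_sum_ext => k; rewrite /pi_tau /Rdiv; ring.
Qed.

Lemma pi_ge0 k : 0 <= pi k.
Proof.
have P0 := Phi_gt0; apply: Rmult_le_pos; last by apply/Rlt_le/Rinv_0_lt_compat.
by apply: Rmult_le_pos; [apply: pow_le; lra|exact: omega_ge0].
Qed.

Lemma pi_gt0 k : 0 < omega S k <-> 0 < pi k.
Proof.
have P0 := Phi_gt0; split => h.
  by apply: Rdiv_lt_0_compat => //; apply: Rmult_lt_0_compat => //; exact: pow_lt.
have [//|e] := omega_ge0 S k; move: h.
by rewrite /pi_tau -e Rmult_0_r /Rdiv Rmult_0_l; lra.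
Qed.

Lemma pi_kmass d : pi d * (kmass S d / kmass S d) = pi d.
Proof.
rewrite -[in RHS](Rmult_1_r (pi d)) /pi_tau /Rdiv -[in RHS]omega_kmass /Rdiv; ring.
Qed.

Lemma pi_dvd k : 0 < pi k -> (span %| k)%N.
Proof. by move/pi_gt0; exact: (proj1 span_ok). Qed.

Lemma pi_span d' : (forall k, 0 < pi k -> (d' %| k)%N) -> (d' %| span)%N.
Proof. by move=> h; apply: (proj2 span_ok) => k /pi_gt0; exact: h. Qed.

Lemma pi_local_limit eps : 0 < eps -> exists K delta n0,
  INR span / PI * exp (- ((V / Phi - 1) / 2)) <= K /\ 0 < delta /\
  forall N, (n0 <= N)%N -> forall L, (L <= N)%N -> INR L <= delta * sqrt (INR N) ->
  (span %| N - L)%N -> forall B, (N - L <= B)%N ->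
  Rabs (sqrt (INR N) * ((\poly_(k < B.+1) pi k) ^+ N)%R`_(N - L) - K) <= eps.
Proof.
apply: local_limit; [exact: pi_ge0|exact: pi_sum0|exact: pi_sum1|exact: pi_sum2| | |
  exact: pi_dvd|exact: pi_span].
  exact/pi_gt0.
by have [k [k2 hk]] := omega2; exists k; split; [exact: ltnW|exact/pi_gt0].
Qed.

(** The vertices other than the root number the sum of the outdegrees, and positive probability
    forces each outdegree to be a multiple of [span]. *)
Lemma lawN_neq0_mod k t : lawN S pi k t <> 0 -> nodes t + leaves t = 1 %[mod span].
Proof.
elim: k t => [|k IH] [|d a ch]; [by []|by case|by case|].
case: (eqVneq (size ch) d) => [e|ne]; last by rewrite /= (negbTE ne).
rewrite lawN_node // => h.
have hd : (span %| size ch)%N.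
  rewrite e; apply: pi_dvd; have [//|h0] := pi_ge0 d.
  by case: h; rewrite -h0 !Rmult_0_l.
have {h} : \rprod_(c <- ch) lawN S pi k c <> 0 by move=> h0; apply: h; rewrite h0 Rmult_0_r.
move=> h; rewrite [nodes _]/= [leaves _]/= addSn -addn1.
rewrite -[in RHS](add0n 1%N); apply/eqP; rewrite eqn_modDr; apply/eqP.
transitivity (size ch %% span)%N; last by rewrite mod0n; apply/eqP.
elim: (ch) h => [|c l IHl] //=; rewrite big_cons => h.
rewrite addnACA -(modnDm (nodes c + _)) IHl; last by move=> h0; apply: h; rewrite h0 Rmult_0_r.
by rewrite IH ?modnDm // => h0; apply: h; rewrite h0 Rmult_0_l.
Qed.

Lemma coef_exp_pi B N a : (a <= B)%N ->
  Phi ^ N * ((\poly_(k < B.+1) pi k) ^+ N)%R`_a =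
  tau ^ a * ((\poly_(k < B.+1) omega S k) ^+ N)%R`_a.
Proof.
have P0 := Phi_gt0; elim: N a => [|N IH] a aB.
  by rewrite !GRing.expr0 coef1; case: eqP => [->|_] /=; rewrite ?Rmult_0_r ?Rmult_1_l.
rewrite !coef_phi_expS // -tech_pow_Rmult.
change (Phi * Phi ^ N * (\rsum_(j < a.+1) (pi j * ((\poly_(k < B.+1) pi k) ^+ N)%R`_(a - j))) =
  tau ^ a * \rsum_(j < a.+1) (omega S j * ((\poly_(k < B.+1) omega S k) ^+ N)%R`_(a - j))).
rewrite !big_distrr; apply: eq_bigr => j _ /=.
transitivity (tau ^ j * omega S j * (Phi ^ N * ((\poly_(k < B.+1) pi k) ^+ N)%R`_(a - j))).
  by rewrite {1}/pi_tau; field; lra.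
rewrite IH; last by apply: leq_trans (leq_subr _ _) _.
have -> : tau ^ a = tau ^ j * tau ^ (a - j).
  by rewrite -pow_add plusE subnKC // -ltnS.
ring.
Qed.

(** Lagrange inversion after tilting: up to powers of [tau] and [Phi], forests of [L] trees with [N]
    vertices have weight [L / N] times the probability that [N] steps sum to [N - L]. *)
Lemma forest_coef n N L : (N <= n)%N -> (L <= N)%N ->
  INR N * ((\poly_(i < n.+1) Zn S i) ^+ L)%R`_N * tau ^ (N - L) =
  INR L * Phi ^ N * ((\poly_(k < n.+1) pi k) ^+ N)%R`_(N - L).
Proof.
move=> Nn LN; rewrite [RHS]Rmult_assoc coef_exp_pi; last by apply: leq_trans (leq_subr _ _) _.
have f0 : Zn S 0 = 0%R by rewrite /Zn rsumE big_nil.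
have := lagrange_forest f0 (@Zn_recursion S n) Nn LN; rewrite -!INRE => h.
transitivity (INR L * ((\poly_(k < n.+1) omega S k) ^+ N)%R`_(N - L) * tau ^ (N - L)).
  by congr (_ * _).
ring.
Qed.

Lemma law_Tn_ge0 k n t : 0 <= law_Tn S k n t.
Proof.
have Z0 : 0 <= Zn S n by rewrite /Zn rsumE; apply: rsum_ge0 => T; exact: shape_weight_ge0.
rewrite /law_Tn rsumE; apply: rsum_ge0 => T; rewrite rsumE; apply: Rmult_le_pos.
  have [->|zn] := Req_dec (Zn S n) 0; first by rewrite /Rdiv Rinv_0; lra.
  apply: Rmult_le_pos; first exact: shape_weight_ge0.
  by apply/Rlt_le/Rinv_0_lt_compat; lra.
apply: rsum_ge0 => tb; apply: Rmult_le_pos; first exact: dec_prob_ge0.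
by rewrite /indicator; case: ClassicalEpsilon.excluded_middle_informative => ? /=; lra.
Qed.

Local Notation Q n N a := (((\poly_(k < n.+1) pi k) ^+ N)%R`_a).

(* Both laws carry the factor [lawN]; the quotient of what remains is a quotient of two
   values of a random walk, by the cycle lemma. *)
Lemma law_Tn_ratio k n t : (nodes t < n)%N -> (leaves t <= n - nodes t)%N ->
  0 < Q n n n.-1 ->
  law_Tn S k n t * (INR (n - nodes t) * Q n n n.-1) =
  law_hat S pi k t * (INR n * Q n (n - nodes t) (n - nodes t - leaves t)).
Proof.
move=> mn LN Qpos; have P0 := Phi_gt0; set m := nodes t; set L := leaves t; set N := (n - m)%N.
have N0 : (0 < N)%N by rewrite subn_gt0.
have NR : 0 < INR N by apply: lt_0_INR; apply/ltP.
have n0 : (0 < n)%N by apply: leq_ltn_trans mn.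
have nR : 0 < INR n by apply: lt_0_INR; apply/ltP.
rewrite (law_Tn_trim_gf k t (leqnn n)) /law_hat lawS_lawN -/L.
have e1 := @coef_trim_gf S n tau Phi ltac:(lra) k t n (ltnW mn); rewrite -/m -/L -/N in e1.
have e2 := @forest_coef n N L (leq_subr _ _) LN.
have := @forest_coef n n 1 (leqnn n) n0; rewrite GRing.expr1 -Zn_poly // subn1 => e3.
rewrite -/N in e2; move: e1 e2 e3 Qpos.
move: (Q n n n.-1) (Q n N (N - L)) (Zn S n) (trim_gf n k t)`_n (lawN S pi k t)
  (((\poly_(i < n.+1) Zn S i) ^+ L)%R`_N) => a b Z x l F e1 e2 e3 a0.
rewrite [INR 1]/= Rmult_1_l in e3.
have tp i : 0 < tau ^ i by exact: pow_lt.
have Pp i : 0 < Phi ^ i by exact: pow_lt.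
have Z0 : 0 < Z.
  have h : 0 < INR n * Z * tau ^ n.-1 by rewrite e3; apply: Rmult_lt_0_compat.
  apply: (Rmult_lt_reg_l (INR n * tau ^ n.-1)); first exact: Rmult_lt_0_compat.
  by rewrite Rmult_0_r; lra.
have en : tau ^ n = tau * tau ^ n.-1 by rewrite tech_pow_Rmult prednK.
have en2 : tau ^ n = tau ^ (m + L) * tau ^ (N - L).
  by rewrite -pow_add plusE -addnA subnKC // /N subnKC // ltnW.
have en3 : Phi ^ n = Phi ^ m * Phi ^ N by rewrite -pow_add plusE /N subnKC // ltnW.
have k1 : tau ^ n * (x * INR N) = tau * l * INR L * b * Phi ^ n.
  rewrite en2 en3; transitivity (tau ^ (m + L) * x * (INR N * tau ^ (N - L))); first by ring.
  rewrite e1; transitivity (tau * l * Phi ^ m * (INR N * F * tau ^ (N - L))); first by ring.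
  rewrite e2; ring.
have k2 : tau ^ n * (INR n * Z) = tau * (Phi ^ n * a).
  by rewrite en -e3; ring.
apply: (Rmult_eq_reg_l (tau ^ n * Z)); last by have := Rmult_lt_0_compat _ _ (tp n) Z0; lra.
transitivity (tau ^ n * (x * INR N) * a); first by field; lra.
rewrite k1; transitivity (tau * (Phi ^ n * a) * (INR L * l * b)); first by ring.
rewrite -k2; ring.
Qed.

Lemma good_tree_ratio eps : 0 < eps < 1 -> exists delta n0, 0 < delta /\
  forall n, (n0 <= n)%N -> n = 1 %[mod span] -> forall k t,
  INR (leaves t) <= delta * sqrt (INR n) -> INR (nodes t) <= delta * INR n ->
  (1 - eps) * law_hat S pi k t <= law_Tn S k n t.
Proof.
move=> [eps0 eps1].
set kap := INR span / PI * exp (- ((V / Phi - 1) / 2)).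
have kap0 : 0 < kap.
  apply: Rmult_lt_0_compat; last exact: exp_pos.
  apply: Rdiv_lt_0_compat; last exact: PI_RGT_0.
  apply: lt_0_INR; apply/ltP; have [j [j2 hj]] := omega2.
  have := proj1 span_ok _ hj; case: (posnP span) => // ->.
  by rewrite dvd0n => /eqP e; rewrite e in j2.
have ek : 0 < eps / 2 * kap by apply: Rmult_lt_0_compat; lra.
(* Since [kap <= K] and [kap] does not depend on the precision, the absolute error [eps / 2 * kap]
   is a relative error of at most [eps / 2]. *)
have [K [del [n1 [kK [del0 hl]]]]] := pi_local_limit ek; rewrite -/kap in kK.
have K0 : 0 < K by lra.
have eK : eps / 2 * kap <= eps / 2 * K by apply: Rmult_le_compat_l; lra.
have [n2 hn2] := INR_unbounded (/ del ^ 2).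
(* The bound by 1/2 leaves [N >= n / 2], so [sqrt N >= sqrt n / 2], and [del / 2] then gives
   [L <= del * sqrt N]. The condition from [n2] admits [L = 1] for the whole tree. *)
exists (Rmin (/ 2) (del / 2)), (maxn (2 * n1) (maxn n2 1)).
split; first by apply: Rmin_pos; lra.
move=> n; rewrite !geq_max => /and3P [nn1 nn2 n0] nmod k t hL hm.
(* The congruence behind the local limit theorem requires positive probability; otherwise the left
   side is 0. *)
have [h0|h0] := Req_dec (lawN S pi k t) 0.
  by rewrite /law_hat lawS_lawN h0 !Rmult_0_r; exact: law_Tn_ge0.
have nR : 1 <= INR n by apply: (le_INR 1); apply/leP.
have sn : 0 < sqrt (INR n) by apply: sqrt_lt_R0; lra.
have sn2 : sqrt (INR n) ^ 2 = INR n by rewrite pow2_sqrt; lra.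
have sn1 : 1 <= sqrt (INR n) by rewrite -sqrt_1; apply: sqrt_le_1_alt.
have m2 : INR (nodes t) <= INR n / 2.
  by have := Rmin_l (/ 2) (del / 2) => h; have := Rmult_le_compat_r (INR n) _ _ ltac:(lra) h; lra.
have L2 : INR (leaves t) <= / 2 * sqrt (INR n).
  by have := Rmin_l (/ 2) (del / 2) => h; have := Rmult_le_compat_r (sqrt (INR n)) _ _ ltac:(lra) h; lra.
have L3 : INR (leaves t) <= del / 2 * sqrt (INR n).
  by have := Rmin_r (/ 2) (del / 2) => h; have := Rmult_le_compat_r (sqrt (INR n)) _ _ ltac:(lra) h; lra.
have mn : (nodes t < n)%N by apply/ltP; apply: INR_lt; lra.
set N := (n - nodes t)%N.
have NR : INR N = INR n - INR (nodes t) by rewrite /N minus_INR //; apply/leP; exact: ltnW.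
have sN : / 2 * sqrt (INR n) <= sqrt (INR N).
  apply: Rsqr_incr_0_var; last exact: sqrt_pos.
  by rewrite Rsqr_sqrt /Rsqr; nra.
have LN : (leaves t <= N)%N by apply/leP; apply: INR_le; nra.
have N1 : (n1 <= N)%N.
  apply/leP; apply: INR_le; have : INR (2 * n1) <= INR n by apply: le_INR; apply/leP.
  by rewrite -multE mult_INR [INR 2]/=; lra.
have dN : (span %| N - leaves t)%N.
  have mL := lawN_neq0_mod h0.
  rewrite /N -subnDA -eqn_mod_dvd; first by rewrite nmod mL.
  by move: LN mn; rewrite /N; lia.
have dn : (span %| n - 1)%N by rewrite -eqn_mod_dvd //; apply/eqP.
have d1 : INR 1 <= del * sqrt (INR n).
  rewrite [INR 1]/=; have : INR n2 <= INR n by apply: le_INR; apply/leP.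
  move=> hn; have d2 : 0 < del ^ 2 by exact: pow_lt.
  have : 1 <= (del * sqrt (INR n)) ^ 2.
    rewrite Rpow_mult_distr sn2; have -> : 1 = del ^ 2 * / del ^ 2 by field; lra.
    by apply: Rmult_le_compat_l; lra.
  have : 0 <= del * sqrt (INR n) by apply: Rmult_le_pos; lra.
  nra.
have b1 : (N - leaves t <= n)%N by apply: leq_trans (leq_subr _ _) (leq_subr _ _).
have L4 : INR (leaves t) <= del * sqrt (INR N).
  have := Rmult_le_compat_l del _ _ ltac:(lra) sN; lra.
have nn : (n1 <= n)%N by apply: leq_trans N1 (leq_subr _ _).
have := hl N N1 _ LN L4 dN n b1; have := hl n nn 1%N n0 d1 dn n (leq_subr _ _).
rewrite subn1 => /Rcomplements.Rabs_le_between hA /Rcomplements.Rabs_le_between hB.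
have := @law_Tn_ratio k n t mn LN; rewrite -/N; move: hA hB.
have law0 : 0 <= law_hat S pi k t.
  rewrite /law_hat lawS_lawN; apply: Rmult_le_pos; [exact: pos_INR|exact: lawN_ge0 pi_ge0].
move: (Q n n n.-1) (Q n N (N - leaves t)) (law_Tn S k n t) (law_hat S pi k t) law0 => a b x q q0 hA hB.
have a0 : 0 < a.
  apply: (Rmult_lt_reg_l (sqrt (INR n))) => //; rewrite Rmult_0_r.
  have : eps / 2 * K < K by have := Rmult_lt_compat_r K (eps / 2) 1 K0 ltac:(lra); lra.
  lra.
move/(_ a0) => e.
have Np : 0 < INR N by nra.
have sNp : 0 < sqrt (INR N) by lra.
have sNn : sqrt (INR N) <= sqrt (INR n) by apply: sqrt_le_1_alt; have := pos_INR (nodes t); lra.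
have f1 : (1 - eps) * (sqrt (INR n) * a) <= sqrt (INR N) * b.
  have g1 : (1 - eps) * (sqrt (INR n) * a) <= (1 - eps) * ((1 + eps / 2) * K).
    by apply: Rmult_le_compat_l; lra.
  have g2 : (1 - eps) * ((1 + eps / 2) * K) <= (1 - eps / 2) * K.
    have : 0 <= (eps * eps) * K by apply: Rmult_le_pos; nra.
    lra.
  lra.
have b0 : 0 <= b.
  apply: (Rmult_le_reg_l (sqrt (INR N))) => //; rewrite Rmult_0_r; apply: Rle_trans f1.
  by apply: Rmult_le_pos; [lra|apply/Rlt_le/Rmult_lt_0_compat].
have f2 : (1 - eps) * a <= b.
  apply: (Rmult_le_reg_l (sqrt (INR n))) => //.
  have := Rmult_le_compat_r b _ _ b0 sNn; lra.
apply: (Rmult_le_reg_r (INR N * a)); first exact: Rmult_lt_0_compat.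
rewrite e.
have Nn : INR N <= INR n by have := pos_INR (nodes t); lra.
have f3 : INR N * ((1 - eps) * a) <= INR n * b.
  by apply: Rmult_le_compat => //; [lra|apply: Rmult_le_pos; lra].
have := Rmult_le_compat_l q _ _ q0 f3; lra.
Qed.

Lemma sum_pi_le1 D : \rsum_(d <- iota 0 D.+1) pi d <= 1.
Proof. by rewrite rsum_iota; apply: psum_le_sum pi_sum0; exact: pi_ge0. Qed.

Lemma sum_pi1_le1 D : \rsum_(d <- iota 0 D.+1) (INR d * pi d) <= 1.
Proof.
rewrite rsum_iota; apply: (psum_le_sum _ _ pi_sum1) => k.
by apply: Rmult_le_pos; [exact: pos_INR|exact: pi_ge0].
Qed.

Lemma sum_pi2_le D : \rsum_(d <- iota 0 D.+1) (INR d * (INR d - 1) * pi d) <= V / Phi.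
Proof.
apply: (@Rle_trans _ (\rsum_(d <- iota 0 D.+1) (INR d ^ 2 * pi d))).
  apply: rsum_le => d; apply: Rmult_le_compat_r; first exact: pi_ge0.
  by have := pos_INR d; lra.
rewrite rsum_iota; apply: (psum_le_sum _ _ pi_sum2) => k.
by apply: Rmult_le_pos; [exact: pow2_ge_0|exact: pi_ge0].
Qed.

Lemma sum_pi_lim eta : 0 < eta -> exists D0, forall D, (D0 <= D)%N ->
  1 - eta <= \rsum_(d <- iota 0 D.+1) pi d /\
  1 - eta <= \rsum_(d <- iota 0 D.+1) (INR d * pi d).
Proof.
move=> e0; have [b0 h0] := infinite_sum_psum pi_sum0 e0.
have [b1 h1] := infinite_sum_psum pi_sum1 e0.
exists (maxn b0 b1) => D; rewrite geq_max => /andP [/h0 {}h0 /h1 {}h1].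
have {}h0 := proj1 (Rcomplements.Rabs_le_between _ _) h0.
have {}h1 := proj1 (Rcomplements.Rabs_le_between _ _) h1.
by rewrite !rsum_iota; split; lra.
Qed.

(** The bound of [lsum_Lv_size_le] at the weights [1 / (delta * sqrt n)] and [1 / (delta * n)]. It
    depends on [k] only through [k / sqrt n]: here the growth condition on the heights is spent. *)
Lemma moment_bound_small delta e : 0 < delta -> 0 < e <= 1 -> exists c n0, 0 < c /\
  forall n, (n0 <= n)%N -> forall k, INR k <= c * sqrt (INR n) ->
  / (delta * sqrt (INR n)) + INR k * (/ (delta * INR n) + V / Phi *
    (/ (delta * sqrt (INR n)) + / (delta * INR n) * INR k)) <= e.
Proof.
move=> d0 [e0 e1]; have s0 : 0 <= V / Phi.
  by apply: s_ge0 => D; exact: sum_pi2_le.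
set s := V / Phi in s0 *.
set c := Rmin 1 (e * delta / (4 * (s + 1))).
have ed : 0 < e * delta by exact: Rmult_lt_0_compat.
have c0 : 0 < c by apply: Rmin_pos; [lra|apply: Rdiv_lt_0_compat; lra].
have c1 : c <= 1 by exact: Rmin_l.
have sc : s * c <= e * delta / 4.
  apply: (@Rle_trans _ ((s + 1) * (e * delta / (4 * (s + 1))))).
    by apply: Rmult_le_compat; [lra|lra|lra|exact: Rmin_r].
  by apply: Req_le; field; lra.
have [n0 hn0] := INR_unbounded ((8 / (e * delta)) ^ 2).
exists c, n0.+1; split => // n nn k hk.
have N1 : INR n0 <= INR n by apply: le_INR; apply/leP; exact: ltnW.
have q0 : 0 < 8 / (e * delta) by apply: Rdiv_lt_0_compat; lra.
have nR : 0 < INR n by apply: lt_0_INR; apply/ltP; exact: leq_trans nn.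
have r0 := sqrt_lt_R0 _ nR; have r2 : sqrt (INR n) ^ 2 = INR n by rewrite pow2_sqrt; lra.
have r8 : 8 / (e * delta) <= sqrt (INR n).
  by apply: Rsqr_incr_0_var; [rewrite Rsqr_sqrt /Rsqr; lra|lra].
set r := sqrt (INR n) in hk r0 r2 r8 *.
have a8 : / (delta * r) <= e / 8.
  apply: (Rmult_le_reg_l (delta * r * (8 / (e * delta)))).
    by apply: Rmult_lt_0_compat => //; exact: Rmult_lt_0_compat.
  have -> : delta * r * (8 / (e * delta)) * / (delta * r) = 8 / (e * delta) by field; lra.
  by have -> : delta * r * (8 / (e * delta)) * (e / 8) = r by field; lra.
have a0 : 0 < / (delta * r) by apply: Rinv_0_lt_compat; exact: Rmult_lt_0_compat.
rewrite -r2; have -> : / (delta * r ^ 2) = / (delta * r) * / r by field; lra.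
have kr : INR k * / r <= c.
  apply: (Rmult_le_reg_r r) => //; rewrite Rmult_assoc Rinv_l; lra.
have kr0 : 0 <= INR k * / r.
  by apply: Rmult_le_pos; [exact: pos_INR|apply/Rlt_le/Rinv_0_lt_compat].
have -> : / (delta * r) + INR k * (/ (delta * r) * / r + s * (/ (delta * r) + / (delta * r) * / r * INR k))
  = / (delta * r) * (1 + INR k * / r) + s * (INR k * / r) * / delta * (1 + INR k * / r).
  by field; lra.
move: (INR k * / r) kr kr0 => u kr kr0.
have t1 : / (delta * r) * (1 + u) <= e / 8 * 2 by apply: Rmult_le_compat; lra.
have t2 : s * u * / delta * (1 + u) <= e / 4 * 2.
  have su : s * u <= e * delta / 4 by apply: Rle_trans sc; apply: Rmult_le_compat_l.
  have su0 : 0 <= s * u by apply: Rmult_le_pos.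
  have di : 0 < / delta by exact: Rinv_0_lt_compat.
  apply: Rmult_le_compat; [by apply: Rmult_le_pos; lra|lra| |lra].
  have -> : e / 4 = e * delta / 4 * / delta by field; lra.
  by apply: Rmult_le_compat_r; lra.
lra.
Qed.

(* Only the one-sided bound [law_hat - law_Tn] is controlled tree by tree; the other side
   follows because [law_Tn] has mass at most 1 and [law_hat] mass close to 1. *)
Lemma trim_laws_close (kseq : nat -> nat) :
  (forall eps, 0 < eps -> exists N, forall n, (N <= n)%N ->
      INR (kseq n) <= eps * sqrt (INR n)) ->
  forall eps, 0 < eps -> exists N, forall n, (N <= n)%N -> n = 1 %[mod span] ->
    dTV_le (law_Tn S (kseq n) n) (law_hat S pi (kseq n)) eps.
Proof.
(* The final sum is at most [5 * e]: missing mass [e], quotient [2 * e], atypical trees [2 * e];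
   half of it is below [4 * e <= eps]. *)
move=> hk eps eps0; set e := Rmin eps 1 / 4.
have m0 : 0 < Rmin eps 1 by apply: Rmin_pos; lra.
have e0 : 0 < e by rewrite /e; lra.
have e1 : 4 * e <= 1 by have := Rmin_r eps 1; rewrite /e; lra.
have e2 : 4 * e <= eps by have := Rmin_l eps 1; rewrite /e; lra.
have [delta [n1 [d0 hratio]]] := @good_tree_ratio e ltac:(lra).
have [c [n2 [c0 hmom]]] := @moment_bound_small delta e d0 ltac:(lra).
have [n3 hn3] := hk c c0.
exists (maxn n1 (maxn n2 (maxn n3 1))) => n; rewrite !geq_max => /and4P [nn1 nn2 nn3 n0] nmod l /NoDup_uniq ul.
set k := kseq n; have nR : 0 < INR n by apply: lt_0_INR; apply/ltP.
have r0 := sqrt_lt_R0 _ nR.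
set alpha := / (delta * sqrt (INR n)); set beta := / (delta * INR n).
have al0 : 0 < alpha by apply: Rinv_0_lt_compat; exact: Rmult_lt_0_compat.
have be0 : 0 < beta by apply: Rinv_0_lt_compat; exact: Rmult_lt_0_compat.
have al0' := Rlt_le _ _ al0; have be0' := Rlt_le _ _ be0.
set p := law_Tn S k n; set q := law_hat S pi k.
have q0 t : 0 <= q t.
  by rewrite /q /law_hat lawS_lawN; apply: Rmult_le_pos; [exact: pos_INR|exact: lawN_ge0 pi_ge0].
have qE t : q t = lawN S pi k t * Lv t by rewrite /q /law_hat lawS_lawN Rmult_comm.
have q_neq0 t : q t <> 0 -> lawN S pi k t <> 0 by rewrite qE => h h0; apply: h; rewrite h0 Rmult_0_l.
pose u (t : ttree) := size_fun alpha beta t.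
have u0 t : 0 <= u t by exact: size_fun_ge0.
have [D1 hD1] := lsum_Lv_lim pi_ge0 pi_kmass sum_pi_le1 sum_pi1_le1 sum_pi2_le sum_pi_lim k e0.
(* The test list [l] is arbitrary, so the cap on outdegrees must also cover its members of positive
   probability. *)
have [D2 hD2] : exists D0, forall D, (D0 <= D)%N -> forall t, t \in l -> lawN S pi k t <> 0 ->
    t \in trim_enum S D k.
  elim: (l) => [|t l' [D' hD']]; first by exists 0%N.
  have [h0|h0] := Req_dec (lawN S pi k t) 0.
    by exists D' => D DD t'; rewrite inE => /orP [/eqP ->|/(hD' D DD) //]; case.
  have [D3 hD3] := lawN_neq0_mem h0; exists (maxn D' D3) => D; rewrite geq_max => /andP [a1 a2] t'.
  by rewrite inE => /orP [/eqP -> _|/(hD' D a1) //]; exact: hD3.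
set D := maxn D1 D2; set E := trim_enum S D k.
have [_ hA] := hD1 D (leq_maxl _ _); have lE := hD2 D (leq_maxr _ _).
(* Enlarging the test list only increases the sum of absolute differences and makes it carry almost
   all the modified mass. *)
set l2 := l ++ [seq t <- E | t \notin l].
have ul2 : uniq l2.
  rewrite cat_uniq ul filter_uniq ?uniq_trim_enum // andbT /=.
  by apply/hasPn => t; rewrite mem_filter => /andP [].
have l2E t : t \in l2 -> lawN S pi k t <> 0 -> t \in E.
  by rewrite mem_cat mem_filter => /orP [|/andP []] // tl; exact: lE.
have sum_p : \rsum_(t <- l2) p t <= 1 by exact: sum_law_Tn_le1.
have sum_q : 1 - e <= \rsum_(t <- l2) q t.
  apply: Rle_trans hA _; rewrite /lsum.
  apply: (@Rle_trans _ (\rsum_(t <- E) q t)); first by apply: rsum_le => t; rewrite qE; lra.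
  apply: rsum_uniq_le => // [|t tE _]; first exact: uniq_trim_enum.
  by rewrite mem_cat mem_filter tE andbT orbN.
have sum_q1 : \rsum_(t <- l2) q t <= 1.
  apply: Rle_trans (lsum_Lv_le1 pi_ge0 pi_kmass sum_pi_le1 sum_pi1_le1 D k); rewrite /lsum.
  apply: (@Rle_trans _ (\rsum_(t <- E) q t)); last by apply: rsum_le => t; rewrite qE; lra.
  by apply: rsum_uniq_le => // t tl /q_neq0; exact: l2E.
have sum_qu : \rsum_(t <- l2) (q t * u t) <= e.
  apply: Rle_trans (hmom n nn2 k (hn3 n nn3)).
  apply: Rle_trans (lsum_Lv_size_le pi_ge0 pi_kmass sum_pi_le1 sum_pi1_le1 sum_pi2_le al0' be0' D k).
  apply: (@Rle_trans _ (\rsum_(t <- E) (q t * u t))); last first.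
    by apply: rsum_le => t; rewrite qE /u; lra.
  apply: rsum_uniq_le => // [t|t tl h]; first exact: Rmult_le_pos.
  by apply: l2E => // h0; apply: h; rewrite qE h0 !Rmult_0_l.
(* Writing the absolute value as [p - q] plus twice a bound for the positive part of [q - p]. If
   [u t >= 1] that bound is [q t * u t], as in Markov's inequality; otherwise both counts are small
   and [good_tree_ratio] applies. *)
have pointwise t : Rabs (p t - q t) <= (p t - q t) + 2 * (e * q t + q t * u t).
  have qt := q0 t; have qu := Rmult_le_pos _ _ qt (u0 t).
  have eq := Rmult_le_pos _ _ (Rlt_le _ _ e0) qt.
  suff : q t - p t <= e * q t + q t * u t by move=> h; apply: Rabs_le; lra.
  have p0 : 0 <= p t by exact: law_Tn_ge0.
  have [u1|u1] := Rle_dec 1 (u t).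
    by have := Rmult_le_compat_l _ _ _ qt u1; lra.
  have hL : 0 <= alpha * INR (leaves t) by apply: Rmult_le_pos => //; exact: pos_INR.
  have hm : 0 <= beta * INR (nodes t) by apply: Rmult_le_pos => //; exact: pos_INR.
  have u1' : alpha * INR (leaves t) + beta * INR (nodes t) < 1.
    by move: u1; rewrite /u /size_fun /Lv; lra.
  have gL : INR (leaves t) <= delta * sqrt (INR n).
    apply: (Rmult_le_reg_l alpha) => //.
    have -> : alpha * (delta * sqrt (INR n)) = 1 by rewrite /alpha; field; lra.
    lra.
  have gm : INR (nodes t) <= delta * INR n.
    apply: (Rmult_le_reg_l beta) => //.
    have -> : beta * (delta * INR n) = 1 by rewrite /beta; field; lra.
    lra.
  by have := hratio n nn1 nmod k t gL gm; rewrite -/p -/q; lra.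
rewrite rsumE; apply: (@Rle_trans _ (/ 2 * \rsum_(t <- l2) Rabs (p t - q t))).
  apply: Rmult_le_compat_l; first lra.
  rewrite big_cat -[X in X <= _]Rplus_0_r; apply: Rplus_le_compat_l.
  by apply: rsum_ge0 => t; exact: Rabs_pos.
have := rsum_le l2 pointwise.
have -> : \rsum_(t <- l2) (p t - q t + 2 * (e * q t + q t * u t)) =
  (\rsum_(t <- l2) p t) + (\rsum_(t <- l2) q t) * (2 * e - 1) + 2 * \rsum_(t <- l2) (q t * u t).
  rewrite big_distrl big_distrr -!big_split; apply: eq_bigr => t _ /=; ring.
have : (\rsum_(t <- l2) q t) * (2 * e) <= 1 * (2 * e) by apply: Rmult_le_compat_r; lra.
lra.
Qed.

End Assembly.

Unset Implicit Arguments.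

Theorem mainTheorem3 (S : wspecies) (span : nat) (tau Phi : R) (kseq : nat -> nat) :
  0 < omega S 0 ->
  (exists k, (2 <= k)%N /\ 0 < omega S k) ->
  is_span S span ->
  typeIalpha_tau S tau Phi ->
  (forall n, (1 <= kseq n)%N) ->
  (forall eps, 0 < eps -> exists N, forall n, (N <= n)%N ->
      INR (kseq n) <= eps * sqrt (INR n)) ->
  forall eps, 0 < eps -> exists N, forall n, (N <= n)%N ->
    n = 1 %[mod span] ->
    dTV_le (law_Tn S (kseq n) n) (law_hat S (pi_tau S tau Phi) (kseq n)) eps.
Proof.
move=> w0 w2 hspan [tau0 [phi0 [phi1 [V phi2]]]] _.
exact: trim_laws_close w0 w2 hspan tau0 phi0 phi1 phi2 kseq.
Qed.
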